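(* Let $W=W_{B_n}$. The action of $\eta_i$ on the $\mathbb H_W$-module $\mathcal C[\xi_1,\dots,\xi_n]$ is realized as the operator $$\eta_i=t\,\partial_{\xi_i}+v\,\frac{1-\tau_i}{2\xi_i}+u\sum_{k\ne i}\frac2{\xi_i^2-\xi_k^2}\Big((\xi_i-\xi_k)s_{ik}-(\xi_i\tau_i-\xi_k\tau_k)\Big).$$
   Context: All algebras are over $\mathbb C$; $[a,b]_+=ab+ba$. $W_{B_n}$ is the group of signed permutations of $1,\dots,n$; $s_{ij}$ is the transposition of $i,j$, $\overline s_{ij}$ the transposition of $i,j$ coupled with sign changes at $i,j$, $\tau_i$ the sign change at $i$. $W\to S_n$, $\sigma\mapsto\sigma^*$, is the homomorphism forgetting signs ($s_{ij}^*=\overline s_{ij}^*=s_{ij}$, $\tau_i^*=1$); $S_n$ permutes the indices of the $\xi_j$ and of the $\eta_j$. $\mathcal C[\xi_1,\dots,\xi_n]$ is the skew-polynomial algebra generated by $\xi_i$ with $\xi_i\xi_j=-\xi_j\xi_i$ for $i\ne j$ (no condition on $\xi_i^2$). Let $t,u,v\in\mathbb C$. The odd double affine Hecke algebra $\mathbb H_W$ of type $B_n$ is generated by $\xi_i,\eta_i$ ($1\le i\le n$) and $\mathbb C W$ subject to: $\eta_i\eta_j=-\eta_j\eta_i$, $\xi_i\xi_j=-\xi_j\xi_i$ ($i\ne j$); $\sigma\xi_j=\xi_j^{\sigma^*}\sigma$, $\sigma\eta_j=\eta_j^{\sigma^*}\sigma$ ($\sigma\in W$); $[\eta_i,\xi_j]_+=u(s_{ij}+\overline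 s_{ij})$ ($i\ne j$), $[\eta_i,\xi_i]_+=t+u\sum_{k\ne i}(s_{ki}+\overline s_{ki})+v\tau_i$. The module: let $\mathfrak h_\eta\subset\mathbb H_W$ be the subalgebra generated by the $\eta_i$ and $\mathbb C W$; let $V$ be the trivial one-dimensional $\mathbb C W$-module, extended to $\mathfrak h_\eta$ by letting each $\eta_i$ act by $0$. The induced module $\mathrm{Ind}_{\mathfrak h_\eta}^{\mathbb H_W}V$ is identified with $\mathcal C[\xi_1,\dots,\xi_n]$; here $\xi_i$ acts by left multiplication and $\sigma\in W$ acts as $f\mapsto f^{\sigma^*}$ (so the group elements $\tau_i\in W$ act trivially on the module). In the formula the symbols are operators on $\mathcal C[\xi_1,\dots,\xi_n]$: $s_{ik}$ is the algebra automorphism exchanging $\xi_i$ and $\xi_k$; $\tau_i$ is the sign-change automorphism $\xi_i\mapsto-\xi_i$, $\xi_j\mapsto\xi_j$ ($j\ne i$) (not the trivial module action of $\tau_i\in W$); $\xi_i$ is left multiplication; $\frac{1-\tau_i}{2\xi_i}$ means $\frac1{2\xi_i}\cdot(1-\tau_i)$, with $\frac1{2\xi_i}$ multiplied on the left; $\xi_i^2-\xi_k^2$ is central, and division by it is applied to the result (which is divisible by it). $\partial_{\xi_i}$ is the super derivation with $\partial_{\xi_i}(\xi_j)=\delta_{ij}$ and $\partial_{\xi_i}(\xi_{a_1}\cdots\xi_{a_l})=\sum_k(-1)^{k-1}\xi_{a_1}\cdots\xi_{a_{k-1}}\partial_{\xi_i}(\xi_{a_k})\xi_{a_{k+1}}\cdots\xi_{a_l}$.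 *)

(* Defs.v *)
From HB Require Import structures.
From mathcomp Require Import all_boot all_order all_fingroup all_algebra.
From mathcomp Require Import finmap.
From mathcomp Require Import boolp classical_sets.
From mathcomp Require Import generic_quotient ring_quotient monalg.

Set Implicit Arguments.
Unset Strict Implicit.
Unset Printing Implicit Defensive.

Import GRing.Theory.
Local Open Scope ring_scope.
Local Open Scope quotient_scope.

Section LinearExtension.

Variables (G : zmodType) (X : choiceType) (M : zmodType).
Variable h : X -> G -> M.

(* The additive map on formal sums sending c x to h x c *)
Definition mext (p : {malg G[X]}) : M := \sum_(x <- msupp p) h x p@_x.

Hypothesis hB : forall x, {morph h x : a b / a - b}.

Lemma mext_h0 x : h x 0 = 0.
Proof. by have := hB x 0 0; rewrite !subrr. Qed.

Lemma mextw (d : {fset X}) p :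
  (msupp p `<=` d)%fset -> mext p = \sum_(x <- d) h x p@_x.
Proof.
move=> le; rewrite /mext [LHS](big_fset_incl _ le) //= => x _ /mcoeff_outdom ->.
exact: mext_h0.
Qed.

Lemma mextB : {morph mext : p q / p - q}.
Proof.
move=> p q; set d := (msupp p `|` msupp q)%fset.
rewrite (@mextw d p) ?fsubsetUl // (@mextw d q) ?fsubsetUr //.
rewrite (@mextw d) ?msuppB_le // -sumrB.
by apply: eq_bigr => x _; rewrite mcoeffB hB.
Qed.

Lemma mext0 : mext 0 = 0.
Proof. by have := mextB 0 0; rewrite !subrr. Qed.

Lemma mextD : {morph mext : p q / p + q}.
Proof.
by move=> p q; rewrite -[LHS](subrK (mext q)) -mextB addrK.
Qed.

Lemma mextU c x : mext << c *g x >> = h x c.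
Proof. by rewrite (mextw msuppU_le) big_seq_fset1 mcoeffUU. Qed.

Lemma mext_sum (J : Type) (s : seq J) (P : pred J) (F : J -> {malg G[X]}) :
  mext (\sum_(j <- s | P j) F j) = \sum_(j <- s | P j) mext (F j).
Proof. by apply: (big_morph mext); [exact: mextD | exact: mext0]. Qed.

End LinearExtension.

Section FreeAlgebra.

Variables (K : comNzRingType) (I : choiceType).

Definition freealg := {malg K[{fmonom I}]}.
HB.instance Definition _ := GRing.Lmodule.on freealg.

(* The multiplication of [malg], i.e. concatenation of words extended
   bilinearly. [locked], here and below, only prevents unfolding during
   unification. *)
Definition fmul : freealg -> freealg -> freealg :=
  locked (fun p q : {malg K[{fmonom I}]} => p * q).

Lemma fmulE (p q : {malg K[{fmonom I}]}) : fmul p q = p * q.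
Proof. by rewrite /fmul -lock. Qed.

Lemma fmulA : associative fmul.
Proof. by move=> p q s; rewrite !fmulE mulrA. Qed.
Lemma fmul1 : left_id (1 : {malg K[{fmonom I}]}) fmul.
Proof. by move=> p; rewrite !fmulE mul1r. Qed.
Lemma fmulr1 : right_id (1 : {malg K[{fmonom I}]}) fmul.
Proof. by move=> p; rewrite !fmulE mulr1. Qed.
Lemma fmulDl : left_distributive fmul +%R.
Proof. by move=> p q s; rewrite !fmulE mulrDl. Qed.
Lemma fmulDr : right_distributive fmul +%R.
Proof. by move=> p q s; rewrite !fmulE mulrDr. Qed.
Lemma fone_neq0 : (1 : {malg K[{fmonom I}]}) != 0.
Proof. exact: oner_neq0. Qed.

HB.instance Definition _ := GRing.Zmodule_isNzRing.Build freealg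
  fmulA fmul1 fmulr1 fmulDl fmulDr fone_neq0.

Lemma fscalerAl (c : K) (p q : freealg) : c *: fmul p q = fmul (c *: p) q.
Proof. by rewrite !fmulE; exact: scalerAl. Qed.

HB.instance Definition _ := GRing.Lmodule_isLalgebra.Build K freealg fscalerAl.

Definition fgen : I -> freealg := locked (fun i => << fmu i >>).

Section Representation.

Variables (M : lmodType K) (A : I -> M -> M).

(* The action of noncommutative polynomials on M when the i-th variable
   acts by A i. *)
Definition frep (p : freealg) (x : M) : M :=
  mext (fun (w : {fmonom I}) (c : K) => c *: foldr A x w) p.

Hypothesis A_lin : forall i, linear (A i).

Let hB x (w : {fmonom I}) : {morph (fun c : K => c *: foldr A x w) : a b / a - b}.
Proof. by move=> a b; rewrite scalerBl. Qed.

Lemma foldr_linear (w : seq I) : linear (fun x => foldr A x w).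
Proof. by move=> c x y; elim: w => //= i w ->; rewrite A_lin. Qed.

Lemma frepB x : {morph frep^~ x : p q / p - q}.
Proof. exact: mextB. Qed.

Lemma frepD x : {morph frep^~ x : p q / p + q}.
Proof. exact: mextD. Qed.

Lemma frep0 x : frep 0 x = 0.
Proof. exact: mext0. Qed.

Lemma frepU c (w : {fmonom I}) x : frep << c *g w >> x = c *: foldr A x w.
Proof. exact: (mextU (hB x)). Qed.

Lemma frep_linear p : linear (frep p).
Proof.
move=> c x y; rewrite /frep /mext scaler_sumr -big_split /=.
apply: eq_bigr => w _; rewrite foldr_linear scalerDr !scalerA.
by rewrite [c * _]mulrC.
Qed.

Lemma frep_r0 p : frep p 0 = 0.
Proof.
by have := frep_linear p (-1) 0 0; rewrite scaler0 addr0 scaleN1r addNr.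
Qed.

Lemma frep_sum p (J : Type) (s : seq J) (P : pred J) (F : J -> M) :
  frep p (\sum_(j <- s | P j) F j) = \sum_(j <- s | P j) frep p (F j).
Proof.
apply: (big_morph (frep p)) => [x y|]; last exact: frep_r0.
by rewrite -[x in LHS]scale1r frep_linear scale1r.
Qed.

Lemma frepZ p c x : frep p (c *: x) = c *: frep p x.
Proof. by rewrite -[c *: x]addr0 frep_linear frep_r0 addr0.
Qed.

Lemma frepM p q x : frep (p * q) x = frep p (frep q x).
Proof.
rewrite [p * q]fmulE malgME exchange_big /= [frep q x]/frep /mext frep_sum.
rewrite {1}/frep (mext_sum (hB x)); apply: eq_bigr => w2 _.
rewrite (mext_sum (hB x)) frepZ [in RHS]/frep [in RHS]/mext scaler_sumr.
apply: eq_bigr => w1 _; rewrite (mextU (hB x)).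
by rewrite [RHS]scalerA [X in X *: _]mulrC fmM foldr_cat.
Qed.

Lemma frep1 x : frep 1 x = x.
Proof. by rewrite frepU fm1 scale1r. Qed.

Lemma frep_gen i x : frep (fgen i) x = A i x.
Proof. by rewrite /fgen -lock frepU fmU scale1r. Qed.

Lemma frepZl c p x : frep (c *: p) x = c *: frep p x.
Proof. by rewrite -[c *: p]mul_malgC -fmulE frepM frepU fm1. Qed.

End Representation.

Lemma freealg_scalerAr (c : K) (p q : freealg) : c *: (p * q) = p * (c *: q).
Proof.
pose c' : freealg := malgC c.
have Z (s : freealg) : c *: s = c' * s by rewrite [c' * s]fmulE mul_malgC.
rewrite !Z !mulrA; congr (_ * _).
rewrite [LHS]fmulE [RHS]fmulE !malgM_def fgmulUg fgmulgU.
by apply: eq_bigr => v _; rewrite mul1m mulm1 mulrC.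
Qed.

Definition is_ideal (J : freealg -> Prop) : Prop :=
  [/\ J 0, forall p q, J p -> J q -> J (p - q)
    & forall a p b, J p -> J (a * p * b)].

(* The two-sided ideal generated by the differences p - q of the two sides
   of the relations p = q listed in r. *)
Definition ideal_of (r : freealg -> freealg -> Prop) : {pred freealg} :=
  fun p => `[< forall J, is_ideal J -> (forall a b, r a b -> J (a - b)) -> J p >].

Variable r : freealg -> freealg -> Prop.

Lemma ideal_ofP p : reflect
  (forall J, is_ideal J -> (forall a b, r a b -> J (a - b)) -> J p)
  (p \in ideal_of r).
Proof. exact: asboolP. Qed.

Lemma ideal_of_rel a b : r a b -> a - b \in ideal_of r.
Proof. by move=> rab; apply/ideal_ofP => J _; exact. Qed.

Lemma ideal_ofM a p b : p \in ideal_of r -> a * p * b \in ideal_of r.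
Proof.
by move=> /ideal_ofP Hp; apply/ideal_ofP => J JI Jr; case: (JI) => _ _; apply; exact: Hp.
Qed.

Lemma ideal_of_closed : zmod_closed (ideal_of r).
Proof.
split=> [|p q /ideal_ofP Hp /ideal_ofP Hq]; apply/ideal_ofP => J JI Jr.
  by case: JI.
by case: (JI) => _ + _; apply; [exact: Hp | exact: Hq].
Qed.

HB.instance Definition _ :=
  GRing.isZmodClosed.Build freealg (ideal_of r) ideal_of_closed.

(* The algebra with generators I and relations r; it may be the zero ring, so
   it carries only the structure of a [pzRingType] and of a K-module. *)
Definition pres := ring_quotient.Quotient.quot (ideal_of r).

HB.instance Definition _ := GRing.Zmodule.on pres.

Definition ppi : freealg -> pres := locked (fun p => \pi_pres p).
Definition prepr : pres -> freealg := locked (fun x => repr x).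

Lemma ppiK (x : pres) : ppi (prepr x) = x.
Proof. by rewrite /ppi /prepr -!lock; exact: reprK. Qed.

Lemma ppi_eq p q : ppi p = ppi q <-> p - q \in ideal_of r.
Proof.
rewrite /ppi -lock -[_ \in _]/(ring_quotient.Quotient.equiv (ideal_of r) p q).
split.
  by move=> /eqP; rewrite piE.
by move=> H; apply/eqP; rewrite piE.
Qed.

Lemma ppi_prepr p : prepr (ppi p) - p \in ideal_of r.
Proof. by apply/ppi_eq; rewrite ppiK. Qed.

Lemma ppiB : {morph ppi : p q / p - q}.
Proof. by move=> p q; rewrite /ppi -lock !piE. Qed.

Lemma ppiD : {morph ppi : p q / p + q}.
Proof. by move=> p q; rewrite /ppi -lock !piE. Qed.

Lemma ppiN : {morph ppi : p / - p}.
Proof. by move=> p; rewrite /ppi -lock !piE. Qed.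

Lemma ppi0 : ppi 0 = 0.
Proof. by rewrite /ppi -lock !piE. Qed.

Definition pres_one : pres := ppi 1.
Definition pres_mul : pres -> pres -> pres :=
  locked (fun x y => ppi (prepr x * prepr y)).
Definition pres_scale : K -> pres -> pres :=
  locked (fun c x => ppi (c *: prepr x)).

Lemma pres_mulE p q : pres_mul (ppi p) (ppi q) = ppi (p * q).
Proof.
rewrite /pres_mul -lock; apply/ppi_eq; set p' := prepr (ppi p); set q' := prepr (ppi q).
have -> : p' * q' - p * q = (p' - p) * q' + p * (q' - q).
  by rewrite mulrBl mulrBr addrA subrK.
apply: rpredD.
  by rewrite -[X in X \in _]mul1r mulrA ideal_ofM // ppi_prepr.
by rewrite -[X in X \in _]mulr1 ideal_ofM // ppi_prepr.
Qed.

Lemma pres_scaleE c p : pres_scale c (ppi p) = ppi (c *: p).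
Proof.
rewrite /pres_scale -lock; apply/ppi_eq.
rewrite -scalerBr -[_ *: _]mulr1 -[_ *: _]mul_malgC -fmulE.
by rewrite ideal_ofM // ppi_prepr.
Qed.

Lemma pres_mulA : associative pres_mul.
Proof.
by move=> x y z; rewrite -[x]ppiK -[y]ppiK -[z]ppiK !pres_mulE mulrA.
Qed.
Lemma pres_mul1 : left_id pres_one pres_mul.
Proof. by move=> x; rewrite -[x]ppiK /pres_one !pres_mulE mul1r. Qed.
Lemma pres_mulr1 : right_id pres_one pres_mul.
Proof. by move=> x; rewrite -[x]ppiK /pres_one !pres_mulE mulr1. Qed.
Lemma pres_mulDl : left_distributive pres_mul +%R.
Proof.
move=> x y z; rewrite -[x]ppiK -[y]ppiK -[z]ppiK.
by rewrite -ppiD !pres_mulE -ppiD mulrDl.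
Qed.
Lemma pres_mulDr : right_distributive pres_mul +%R.
Proof.
move=> x y z; rewrite -[x]ppiK -[y]ppiK -[z]ppiK.
by rewrite -ppiD !pres_mulE -ppiD mulrDr.
Qed.

HB.instance Definition _ := GRing.Zmodule_isPzRing.Build pres
  pres_mulA pres_mul1 pres_mulr1 pres_mulDl pres_mulDr.

Lemma pres_scaleA a b x : pres_scale a (pres_scale b x) = pres_scale (a * b) x.
Proof. by rewrite -[x]ppiK !pres_scaleE scalerA. Qed.
Lemma pres_scale1 : left_id 1 pres_scale.
Proof. by move=> x; rewrite -[x]ppiK pres_scaleE scale1r. Qed.
Lemma pres_scaleDr : right_distributive pres_scale +%R.
Proof.
move=> c x y; rewrite -[x]ppiK -[y]ppiK.
by rewrite -ppiD !pres_scaleE -ppiD scalerDr.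
Qed.
Lemma pres_scaleDl x : {morph pres_scale^~ x : a b / a + b}.
Proof. by move=> a b; rewrite -[x]ppiK !pres_scaleE -ppiD scalerDl. Qed.

HB.instance Definition _ := GRing.Zmodule_isLmodule.Build K pres
  pres_scaleA pres_scale1 pres_scaleDr pres_scaleDl.

Lemma ppiM : {morph ppi : p q / p * q}.
Proof. by move=> p q; rewrite -pres_mulE. Qed.

Lemma ppi1 : ppi 1 = 1.
Proof. by []. Qed.

Lemma ppiZ c : {morph ppi : p / c *: p}.
Proof. by move=> p; rewrite -pres_scaleE. Qed.

Lemma pres_scalerAl (c : K) (x y : pres) : c *: (x * y) = (c *: x) * y.
Proof. by rewrite -[x]ppiK -[y]ppiK -ppiM -!ppiZ -ppiM scalerAl. Qed.

Lemma pres_scalerAr (c : K) (x y : pres) : c *: (x * y) = x * (c *: y).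
Proof.
by rewrite -[x]ppiK -[y]ppiK -ppiM -!ppiZ -ppiM freealg_scalerAr.
Qed.

Definition pgen (i : I) : pres := ppi (fgen i).

Lemma pres_rel a b : r a b -> ppi a = ppi b.
Proof. by move=> /ideal_of_rel /ppi_eq. Qed.

(* Universal property: operators satisfying the relations make M a module. *)
Lemma frep_ideal (M : lmodType K) (A : I -> M -> M) :
    (forall i, linear (A i)) ->
    (forall a b, r a b -> forall x, frep A a x = frep A b x) ->
  forall p q, ppi p = ppi q -> forall x, frep A p x = frep A q x.
Proof.
move=> Al Ar p q /ppi_eq /ideal_ofP /(_ (fun p => forall x, frep A p x = 0)) H x.
apply/eqP; rewrite -subr_eq0 -frepB //; apply/eqP; apply: H.
- split.
  + by move=> y; rewrite frep0.
  + by move=> a b Ha Hb y; rewrite frepB Ha Hb subr0.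
  + by move=> a b c Hb y; rewrite !frepM // Hb frep_r0.
- by move=> a b rab y; rewrite frepB (Ar _ _ rab) subrr.
Qed.

End FreeAlgebra.

Arguments pgen {K I} r i.
Arguments ppi {K I} r p.

Section Morphisms.

Variables (K : comNzRingType) (I J : choiceType).
Variable r : freealg K I -> freealg K I -> Prop.
Variable r' : freealg K J -> freealg K J -> Prop.
Variable f : I -> pres r'.

Definition feval (p : freealg K I) : pres r' := frep (fun i x => f i * x) p 1.

(* The algebra morphism sending the i-th generator to f i; this is meaningful
   when the f i satisfy the relations r (see [pres_mapE] and [pres_map_morph]). *)
Definition pres_map (x : pres r) : pres r' := feval (prepr x).

Lemma mul_linear i : linear (fun x : pres r' => f i * x).
Proof. by move=> c x y; rewrite mulrDr pres_scalerAr. Qed.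
Hint Resolve mul_linear : core.

Lemma frep_mul p x : frep (fun i x => f i * x) p x = feval p * x.
Proof.
rewrite /feval /frep /mext mulr_suml; apply: eq_bigr => w _.
rewrite -pres_scalerAl; congr (_ *: _).
elim: (w : seq I) => [|i s IH] /=; first by rewrite mul1r.
by rewrite IH mulrA.
Qed.

Lemma fevalM p q : feval (p * q) = feval p * feval q.
Proof. by rewrite {1}/feval frepM // frep_mul. Qed.
Lemma fevalB p q : feval (p - q) = feval p - feval q.
Proof. exact: frepB. Qed.
Lemma fevalD p q : feval (p + q) = feval p + feval q.
Proof. exact: frepD. Qed.
Lemma fevalN p : feval (- p) = - feval p.
Proof. by rewrite -[- p]add0r fevalB {1}/feval frep0 ?sub0r. Qed.
Lemma fevalZ c p : feval (c *: p) = c *: feval p.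
Proof. exact: frepZl. Qed.
Lemma feval1 : feval 1 = 1.
Proof. exact: frep1. Qed.
Lemma feval_gen i : feval (fgen K i) = f i.
Proof. by rewrite /feval frep_gen // mulr1. Qed.

Hypothesis fr : forall a b, r a b -> feval a = feval b.

Lemma pres_mapE p : pres_map (ppi r p) = feval p.
Proof.
have rel a b : r a b -> forall x,
    frep (fun i y => f i * y) a x = frep (fun i y => f i * y) b x.
  by move=> rab x; rewrite !frep_mul (fr rab).
exact: (frep_ideal mul_linear rel (ppiK (ppi r p)) 1).
Qed.

Lemma pres_map_gen i : pres_map (pgen r i) = f i.
Proof. by rewrite pres_mapE feval_gen. Qed.

Lemma pres_map_morph :
  [/\ pres_map 1 = 1, {morph pres_map : x y / x * y} & linear pres_map].
Proof.
split=> [|x y|c x y]; first by rewrite -ppi1 pres_mapE feval1.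
- by rewrite -[x]ppiK -[y]ppiK -ppiM !pres_mapE fevalM.
- by rewrite -[x]ppiK -[y]ppiK -ppiZ -ppiD !pres_mapE fevalD fevalZ.
Qed.

End Morphisms.

Section GeneratedSubalgebra.

Variables (K : comNzRingType) (I : choiceType).
Variable r : freealg K I -> freealg K I -> Prop.
Local Notation A := (pres r).

Definition is_subalgebra (S : A -> Prop) : Prop :=
  [/\ S 1, forall c a b, S a -> S b -> S (c *: a + b)
    & forall a b, S a -> S b -> S (a * b)].

Definition subalg_of (X : A -> Prop) : {pred A} :=
  fun a => `[< forall S, is_subalgebra S -> (forall x, X x -> S x) -> S a >].

Variable X : A -> Prop.

Lemma subalg_ofP a : reflect
  (forall S, is_subalgebra S -> (forall x, X x -> S x) -> S a)
  (a \in subalg_of X).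
Proof. exact: asboolP. Qed.

Lemma mem_subalg_of x : X x -> x \in subalg_of X.
Proof. by move=> Xx; apply/subalg_ofP => S _; apply. Qed.

Lemma subalg_of_closed : subring_closed (subalg_of X).
Proof.
split=> [|a b /subalg_ofP Ha /subalg_ofP Hb|a b /subalg_ofP Ha /subalg_ofP Hb];
  apply/subalg_ofP => S Ssub XS; case: (Ssub) => S1 Sl SM //.
- by rewrite addrC -scaleN1r; apply: Sl; [exact: Hb | exact: Ha].
- by apply: SM; [exact: Ha | exact: Hb].
Qed.

Lemma subalg_of_scalar (c : K) : c *: (1 : A) \in subalg_of X.
Proof.
apply/subalg_ofP => S [S1 Sl _] _.
have S0 : S 0 by rewrite -(addNr 1) -scaleN1r; exact: Sl.
by rewrite -[_ *: _]addr0; exact: Sl.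
Qed.

Definition subalg := {a : A | a \in subalg_of X}.
HB.instance Definition _ := [isSub of subalg for @sval _ _].
HB.instance Definition _ := [Choice of subalg by <:].
HB.instance Definition _ := GRing.SubChoice_isSubPzRing.Build A (subalg_of X)
  subalg subalg_of_closed.

Definition subalg_scalar (c : K) : subalg :=
  exist (fun a => a \in subalg_of X) _ (subalg_of_scalar c).
Definition subalg_gen x (Xx : X x) : subalg :=
  exist (fun a => a \in subalg_of X) _ (mem_subalg_of Xx).

End GeneratedSubalgebra.

Section InducedModule.

Variables (A : pzRingType) (P : pred A) (B : GRing.SubPzRing.type P).
Variable V : lmodType B.

(* The free abelian group on the pairs (a, v). *)
Definition tens_free := {malg int[(A * V)%type]}.
HB.instance Definition _ := GRing.Zmodule.on tens_free.

Definition tens_pair : A -> V -> tens_free := locked (fun a v => << (a, v) >>).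

Inductive tens_relation : tens_free -> tens_free -> Prop :=
| Tens_addl a b v :
    tens_relation (tens_pair (a + b) v) (tens_pair a v + tens_pair b v)
| Tens_addr a v w :
    tens_relation (tens_pair a (v + w)) (tens_pair a v + tens_pair a w)
| Tens_bal a (b : B) v :
    tens_relation (tens_pair (a * val b) v) (tens_pair a (b *: v)).

Definition is_subgroup (J : tens_free -> Prop) : Prop :=
  J 0 /\ forall p q, J p -> J q -> J (p - q).

Definition tens_null : {pred tens_free} := fun p =>
  `[< forall J, is_subgroup J ->
        (forall a b, tens_relation a b -> J (a - b)) -> J p >].

Lemma tens_nullP p : reflect
  (forall J, is_subgroup J -> (forall a b, tens_relation a b -> J (a - b)) -> J p)
  (p \in tens_null).
Proof. exact: asboolP. Qed.

Lemma tens_null_closed : zmod_closed tens_null.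
Proof.
split=> [|p q /tens_nullP Hp /tens_nullP Hq]; apply/tens_nullP => J JI Jr.
  by case: JI.
by case: (JI) => _; apply; [exact: Hp | exact: Hq].
Qed.

HB.instance Definition _ :=
  GRing.isZmodClosed.Build tens_free tens_null tens_null_closed.

(* A (x)_B V, with A acting by left multiplication. When A is an algebra over
   K and B contains the scalars this is also the tensor product of K-modules
   balanced over B. *)
Definition ind_module := ring_quotient.Quotient.quot tens_null.

HB.instance Definition _ := GRing.Zmodule.on ind_module.

Definition tpi : tens_free -> ind_module := locked (fun p => \pi_ind_module p).
Definition trepr : ind_module -> tens_free := locked (fun x => repr x).

Definition tens (a : A) (v : V) : ind_module := tpi (tens_pair a v).

Lemma tpiK (x : ind_module) : tpi (trepr x) = x.
Proof. by rewrite /tpi /trepr -!lock; exact: reprK. Qed.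

Lemma tpi_eq p q : tpi p = tpi q <-> p - q \in tens_null.
Proof.
rewrite /tpi -lock -[_ \in _]/(ring_quotient.Quotient.equiv tens_null p q).
split.
  by move=> /eqP; rewrite piE.
by move=> H; apply/eqP; rewrite piE.
Qed.

Lemma tpiB : {morph tpi : p q / p - q}.
Proof. by move=> p q; rewrite /tpi -lock !piE. Qed.

Lemma tpiD : {morph tpi : p q / p + q}.
Proof. by move=> p q; rewrite /tpi -lock !piE. Qed.

Lemma tpi0 : tpi 0 = 0.
Proof. by have := tpiB 0 0; rewrite !subrr. Qed.

Lemma tpi_rel p q : tens_relation p q -> tpi p = tpi q.
Proof. by move=> rpq; apply/tpi_eq/tens_nullP => J _; apply. Qed.

Lemma tensDl a b v : tens (a + b) v = tens a v + tens b v.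
Proof. by rewrite -tpiD; apply: tpi_rel; exact: Tens_addl. Qed.
Lemma tensDr a v w : tens a (v + w) = tens a v + tens a w.
Proof. by rewrite -tpiD; apply: tpi_rel; exact: Tens_addr. Qed.
Lemma tens_bal a (b : B) v : tens (a * val b) v = tens a (b *: v).
Proof. by apply: tpi_rel; exact: Tens_bal. Qed.

(* a . (b (x) v) = ab (x) v *)
Definition tens_act (a : A) (p : tens_free) : tens_free :=
  mext (fun (x : A * V) (k : int) => << k *g (a * x.1, x.2) >>) p.

Let hB a (x : A * V) :
  {morph (fun k : int => << k *g (a * x.1, x.2) >> : tens_free) : k l / k - l}.
Proof. by move=> k l; rewrite monalgUB. Qed.

Lemma tens_actB a : {morph tens_act a : p q / p - q}.
Proof. exact: mextB. Qed.
Lemma tens_actD a : {morph tens_act a : p q / p + q}.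
Proof. exact: mextD. Qed.
Lemma tens_act0 a : tens_act a 0 = 0.
Proof. exact: mext0. Qed.
Lemma tens_act_pair a b v : tens_act a (tens_pair b v) = tens_pair (a * b) v.
Proof. by rewrite /tens_act /tens_pair -!lock (mextU (hB a)). Qed.

Lemma tens_act_null a p : p \in tens_null -> tens_act a p \in tens_null.
Proof.
move=> /tens_nullP /(_ (fun p => tens_act a p \in tens_null)); apply.
  split=> [|x y Hx Hy]; first by rewrite tens_act0 rpred0.
  rewrite tens_actB; exact: (rpredB Hx Hy).
move=> _ _ [b c v|b v w|b s v];
  rewrite tens_actB ?tens_actD !tens_act_pair; apply/tpi_eq/tpi_rel.
- by rewrite mulrDr; exact: Tens_addl.
- exact: Tens_addr.
- by rewrite mulrA; exact: Tens_bal.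
Qed.

Definition ind_scale (a : A) (x : ind_module) : ind_module := tpi (tens_act a (trepr x)).

Lemma ind_scaleE a p : ind_scale a (tpi p) = tpi (tens_act a p).
Proof.
apply/tpi_eq; rewrite -tens_actB; apply: tens_act_null.
by apply/tpi_eq; rewrite tpiK.
Qed.

(* Two additive maps out of [ind_module] agreeing on pure tensors are equal. *)
Lemma tens_ext (Z : zmodType) (f g : ind_module -> Z) :
    {morph f : x y / x + y} -> {morph g : x y / x + y} ->
  (forall a v, f (tens a v) = g (tens a v)) -> f =1 g.
Proof.
move=> fD gD fg x.
have f0 : f 0 = 0 by apply: (addrI (f 0)); rewrite -fD !addr0.
have g0 : g 0 = 0 by apply: (addrI (g 0)); rewrite -gD !addr0.
have fN y : f (- y) = - f y.
  by apply: (addrI (f y)); rewrite -fD !subrr f0.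
have gN y : g (- y) = - g y.
  by apply: (addrI (g y)); rewrite -gD !subrr g0.
rewrite -[x]tpiK; move: (trepr x) => p {x}.
rewrite [p]monalgE; elim/big_rec: _ => [|k q _ IH].
  by rewrite tpi0 f0 g0.
rewrite tpiD fD gD IH; congr (_ + _); move: k (p@_k) => [a v] m {IH q p}.
have H (n : nat) : f (tpi << n%:Z *g (a, v) >>) = g (tpi << n%:Z *g (a, v) >>).
  elim: n => [|n IH].
    by rewrite monalgU0 tpi0 f0 g0.
  by rewrite -addn1 PoszD monalgUD tpiD fD gD IH; congr (_ + _);
    have := fg a v; rewrite /tens /tens_pair -lock.
case: m => n; first exact: H.
have -> : tpi << Negz n *g (a, v) >> = - tpi << n.+1%:Z *g (a, v) >>.
  by rewrite NegzE monalgUN -[- << _ *g _ >>]add0r tpiB tpi0 sub0r.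
by rewrite fN gN H.
Qed.

Lemma ind_scaleD a : {morph ind_scale a : x y / x + y}.
Proof.
move=> x y; rewrite -[x]tpiK -[y]tpiK -tpiD !ind_scaleE.
by rewrite tens_actD tpiD.
Qed.

Lemma ind_scale_tens a b v : ind_scale a (tens b v) = tens (a * b) v.
Proof. by rewrite ind_scaleE tens_act_pair. Qed.

Lemma ind_scaleA a b x : ind_scale a (ind_scale b x) = ind_scale (a * b) x.
Proof.
move: x; apply: tens_ext => [x y|x y|c v]; rewrite ?ind_scaleD //.
by rewrite !ind_scale_tens mulrA.
Qed.
Lemma ind_scale1 : left_id 1 ind_scale.
Proof.
by apply: tens_ext => [x y|//|c v]; rewrite ?ind_scaleD ?ind_scale_tens ?mul1r.
Qed.
Lemma ind_scaleDl x : {morph ind_scale^~ x : a b / a + b}.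
Proof.
move=> a b; move: x; apply: tens_ext => [x y|x y|c v]; rewrite ?ind_scaleD //.
  by rewrite addrACA.
by rewrite !ind_scale_tens mulrDl tensDl.
Qed.

HB.instance Definition _ := GRing.Zmodule_isLmodule.Build A ind_module
  ind_scaleA ind_scale1 ind_scaleD ind_scaleDl.

Lemma scale_tens (a b : A) v : a *: tens b v = tens (a * b) v.
Proof. exact: ind_scale_tens. Qed.

End InducedModule.

Section SignedPermutations.

Variable n : nat.

(* (s, e) is the signed permutation j |-> (-1)^(e j) s(j) of 1, ..., n. *)
Definition signed_perm := ({perm 'I_n} * {ffun 'I_n -> bool})%type.
HB.instance Definition _ := Finite.on signed_perm.

(* Composition of maps, (a b)(j) = a(b(j)); on permutations MathComp's own
   product is in the opposite order. *)
Definition sperm_mul (a b : signed_perm) : signed_perm :=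
  ((b.1 * a.1)%g, [ffun j => b.2 j (+) a.2 (b.1 j)]).
Definition sperm_one : signed_perm := (1%g, [ffun=> false]).
Definition sperm_inv (a : signed_perm) : signed_perm :=
  (a.1^-1%g, [ffun j => a.2 (a.1^-1%g j)]).

Lemma sperm_mulA : associative sperm_mul.
Proof.
move=> a b c; congr (_, _); rewrite /= ?mulgA //.
by apply/ffunP => j; rewrite !ffunE /= permM addbA.
Qed.
Lemma sperm_mul1 : left_id sperm_one sperm_mul.
Proof.
case=> s e; congr (_, _); rewrite /= ?mulg1 //.
by apply/ffunP => j; rewrite !ffunE addbF.
Qed.
Lemma sperm_mulV : left_inverse sperm_one sperm_inv sperm_mul.
Proof.
case=> s e; congr (_, _); rewrite /= ?mulgV //.
by apply/ffunP => j; rewrite !ffunE /= permK addbb.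
Qed.

HB.instance Definition _ := Finite_isGroup.Build signed_perm
  sperm_mulA sperm_mul1 sperm_mulV.

Definition forget (a : signed_perm) : {perm 'I_n} := a.1.

Lemma forgetM a b j : forget (a * b)%g j = forget a (forget b j).
Proof. exact: permM. Qed.

Definition s_ (i j : 'I_n) : signed_perm := (tperm i j, [ffun=> false]).
Definition sbar_ (i j : 'I_n) : signed_perm :=
  (tperm i j, [ffun k => (k == i) || (k == j)]).
Definition tau_ (i : 'I_n) : signed_perm := (1%g, [ffun k => k == i]).

End SignedPermutations.

Section SkewPolynomials.

Variables (K : comNzRingType) (n : nat).

Inductive skew_relation : freealg K 'I_n -> freealg K 'I_n -> Prop :=
| Skew_xx i j : i != j ->
    skew_relation (fgen K i * fgen K j) (- (fgen K j * fgen K i)).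

Definition skewpoly := pres skew_relation.
HB.instance Definition _ := GRing.PzRing.on skewpoly.
HB.instance Definition _ := GRing.Lmodule.copy skewpoly (pres skew_relation).

Definition xi (i : 'I_n) : skewpoly := pgen skew_relation i.

Lemma xi_anticomm i j : i != j -> xi i * xi j = - (xi j * xi i).
Proof.
by move=> ij; rewrite /xi /pgen -[LHS]ppiM (pres_rel (Skew_xx ij)) ppiN ppiM.
Qed.

Definition skew_perm (s : {perm 'I_n}) : skewpoly -> skewpoly :=
  pres_map (fun j => xi (s j)).

(* The sign-change automorphism; the element tau_ i of W acts on skew
   polynomials by [skew_perm (forget (tau_ i))], which is the identity. *)
Definition skew_sign (i : 'I_n) : skewpoly -> skewpoly :=
  pres_map (fun j => if j == i then - xi j else xi j).

Lemma skew_perm_rel (s : {perm 'I_n}) a b : skew_relation a b ->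
  feval (fun j => xi (s j)) a = feval (fun j => xi (s j)) b.
Proof.
case=> i j ij; rewrite fevalN !fevalM !feval_gen xi_anticomm //.
by rewrite (inj_eq perm_inj).
Qed.

Lemma skew_sign_rel i a b : skew_relation a b ->
  feval (fun j => if j == i then - xi j else xi j) a =
  feval (fun j => if j == i then - xi j else xi j) b.
Proof.
case=> j k jk; rewrite fevalN !fevalM !feval_gen.
case: (j == i); case: (k == i).
- by rewrite !mulrNN; exact: xi_anticomm.
- by rewrite mulNr mulrN opprK xi_anticomm ?opprK.
- by rewrite mulNr mulrN opprK xi_anticomm ?opprK.
- exact: xi_anticomm.
Qed.

Lemma skew_perm_xi s j : skew_perm s (xi j) = xi (s j).
Proof. exact: (pres_map_gen (@skew_perm_rel s)). Qed.

Lemma skew_perm_morph s :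
  [/\ skew_perm s 1 = 1, {morph skew_perm s : f g / f * g}
    & linear (skew_perm s)].
Proof. exact: (pres_map_morph (@skew_perm_rel s)). Qed.

Lemma skew_sign_xi i j :
  skew_sign i (xi j) = if j == i then - xi j else xi j.
Proof. exact: (pres_map_gen (@skew_sign_rel i)). Qed.

Lemma skew_sign_morph i :
  [/\ skew_sign i 1 = 1, {morph skew_sign i : f g / f * g}
    & linear (skew_sign i)].
Proof. exact: (pres_map_morph (@skew_sign_rel i)). Qed.

Definition xi_word (w : seq 'I_n) : skewpoly := \prod_(a <- w) xi a.

(* The super derivation on a monomial; positions are counted from 0, whence
   the sign (-1)^k. *)
Definition sder_word (i : 'I_n) (w : seq 'I_n) : skewpoly :=
  \sum_(k < size w)
    (-1) ^+ k *:
      (xi_word (take k w) * (nth i w k == i)%:R * xi_word (drop k.+1 w)).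

Definition superder (i : 'I_n) (f : skewpoly) : skewpoly :=
  mext (fun (w : {fmonom 'I_n}) (c : K) => c *: sder_word i w) (prepr f).

Lemma sder_word_cons i a w :
  sder_word i (a :: w) = (a == i)%:R * xi_word w - xi a * sder_word i w.
Proof.
rewrite /sder_word big_ord_recl /= expr0 scale1r /xi_word big_nil mul1r drop0.
congr (_ + _); rewrite mulr_sumr -sumrN; apply: eq_bigr => k _ /=.
rewrite /bump add1n exprS mulN1r scaleNr; congr (- _).
by rewrite big_cons -pres_scalerAr !mulrA.
Qed.

(* xi_a acts on pairs (f, g) by (xi_a f, d_i(xi_a) f - xi_a g). *)
Definition sder_pair (i a : 'I_n) (x : skewpoly * skewpoly) : skewpoly * skewpoly :=
  (xi a * x.1, (a == i)%:R * x.1 - xi a * x.2).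

Lemma sder_pair_linear i a : linear (sder_pair i a).
Proof.
move=> c [x1 x2] [y1 y2]; congr (_, _) => /=; rewrite !mulrDr -!pres_scalerAr //.
by rewrite opprD scalerDr scalerN addrACA.
Qed.

Lemma sder_pair_rel i a b : skew_relation a b ->
  forall x, frep (sder_pair i) a x = frep (sder_pair i) b x.
Proof.
have lin := sder_pair_linear i.
case=> j k jk [x y]; rewrite -[- _]sub0r frepB frep0 !(frepM lin) !frep_gen.
rewrite sub0r /sder_pair /=.
have E w : xi j * (xi k * w) = - (xi k * (xi j * w)).
  by rewrite !mulrA xi_anticomm // mulNr.
have com (e : bool) (w z : skewpoly) : e%:R * (w * z) = w * (e%:R * z).
  by case: e; rewrite ?mul1r // !mul0r mulr0.
congr (_, _) => //=; rewrite !mulrBr !com E opprK opprB.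
by rewrite opprD addrA addrAC.
Qed.

Lemma foldr_sder_pair i (w : seq 'I_n) :
  foldr (sder_pair i) (1, 0) w = (xi_word w, sder_word i w).
Proof.
elim: w => [|a w IH] /=.
  by rewrite /xi_word big_nil /sder_word big_ord0.
by rewrite IH sder_word_cons /sder_pair /= /xi_word big_cons.
Qed.

Lemma sder_ppi i p : superder i (ppi skew_relation p) =
  mext (fun (w : {fmonom 'I_n}) (c : K) => c *: sder_word i w) p.
Proof.
have H q : mext (fun (w : {fmonom 'I_n}) (c : K) => c *: sder_word i w) q =
    (frep (sder_pair i) q (1, 0)).2.
  rewrite /frep /mext (big_morph (@snd skewpoly skewpoly) (id1 := 0) (op1 := +%R)) //.
  by apply: eq_bigr => w _; rewrite foldr_sder_pair.
rewrite /superder !H; congr (_.2).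
apply: (@frep_ideal _ _ skew_relation _ (sder_pair i)).
- exact: sder_pair_linear.
- exact: sder_pair_rel.
- exact: ppiK.
Qed.

Lemma sder_xi_word i (w : seq 'I_n) : superder i (xi_word w) = sder_word i w.
Proof.
have -> : xi_word w = ppi skew_relation << FMonom w >>.
  elim: w => [|a w IH]; first by rewrite /xi_word big_nil -fmoneE.
  rewrite /xi_word big_cons -/(xi_word w) IH /xi /pgen -ppiM; congr ppi.
  rewrite /fgen -lock [_ * _]fmulE malgM_def fgmulUU mulr1.
  by congr (mkmalgU _ _); apply: val_inj; rewrite /= fmM fmU.
rewrite sder_ppi mextU ?scale1r // => v a b.
by rewrite scalerBl.
Qed.

Lemma sder_linear i : linear (superder i).
Proof.
move=> c x y; rewrite -[x]ppiK -[y]ppiK -ppiZ -ppiD !sder_ppi.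
have hB (w : {fmonom 'I_n}) : {morph (fun c : K => c *: sder_word i w) : a b / a - b}.
  by move=> a b; rewrite scalerBl.
rewrite mextD //; congr (_ + _).
rewrite (mextw hB (msuppZ_le c (prepr x))) /mext scaler_sumr.
by apply: eq_bigr => w _; rewrite mcoeffZ scalerA.
Qed.

(* d^-1 f: the g such that d g = f, and 0 when there is none; meaningful when
   there is exactly one such g. *)
Definition skew_ldiv (d f : skewpoly) : skewpoly :=
  xget 0 [set g | d * g = f]%classic.

Variables t u v : K.

Definition dunkl_num (i k : 'I_n) (f : skewpoly) : skewpoly :=
  (xi i - xi k) * skew_perm (tperm i k) f
  - (xi i * skew_sign i f - xi k * skew_sign k f).

Definition dunkl (i : 'I_n) (f : skewpoly) : skewpoly :=
  t *: superder i f
  + v *: skew_ldiv (2%:R * xi i) (f - skew_sign i f)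
  + u *: \sum_(k < n | k != i)
      2%:R * skew_ldiv (xi i ^+ 2 - xi k ^+ 2) (dunkl_num i k f).

End SkewPolynomials.

Arguments xi {K n} i.

Section OddDAHA.

Variables (K : comNzRingType) (n : nat) (t u v : K).

Inductive dgen := Dxi of 'I_n | Deta of 'I_n | Dgrp of signed_perm n.

Definition dgen_code (g : dgen) : 'I_n + 'I_n + signed_perm n :=
  match g with Dxi i => inl (inl i) | Deta i => inl (inr i) | Dgrp s => inr s end.
Definition dgen_decode (x : 'I_n + 'I_n + signed_perm n) : dgen :=
  match x with inl (inl i) => Dxi i | inl (inr i) => Deta i | inr s => Dgrp s end.
Lemma dgen_codeK : cancel dgen_code dgen_decode.
Proof. by case. Qed.
HB.instance Definition _ := Choice.copy dgen (can_type dgen_codeK).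

Local Notation F := (freealg K dgen).
Local Notation x_ i := (fgen K (Dxi i)).
Local Notation y_ i := (fgen K (Deta i)).
Local Notation g_ s := (fgen K (Dgrp s)).

Inductive daha_relation : F -> F -> Prop :=
| Daha_grp1 : daha_relation (g_ 1%g) 1
| Daha_grpM a b : daha_relation (g_ a * g_ b) (g_ (a * b)%g)
| Daha_eta i j : i != j -> daha_relation (y_ i * y_ j) (- (y_ j * y_ i))
| Daha_xi i j : i != j -> daha_relation (x_ i * x_ j) (- (x_ j * x_ i))
| Daha_grp_xi a j : daha_relation (g_ a * x_ j) (x_ (forget a j) * g_ a)
| Daha_grp_eta a j : daha_relation (g_ a * y_ j) (y_ (forget a j) * g_ a)
| Daha_eta_xi i j : i != j ->
    daha_relation (y_ i * x_ j + x_ j * y_ i) (u *: (g_ (s_ i j) + g_ (sbar_ i j)))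
| Daha_eta_xi_diag i :
    daha_relation (y_ i * x_ i + x_ i * y_ i)
      (t *: 1 + u *: (\sum_(k < n | k != i) (g_ (s_ k i) + g_ (sbar_ k i)))
       + v *: g_ (tau_ i)).

Definition daha := pres daha_relation.
HB.instance Definition _ := GRing.PzRing.on daha.
HB.instance Definition _ := GRing.Lmodule.copy daha (pres daha_relation).

Definition dxi (i : 'I_n) : daha := pgen daha_relation (Dxi i).
Definition deta (i : 'I_n) : daha := pgen daha_relation (Deta i).
Definition dgrp (a : signed_perm n) : daha := pgen daha_relation (Dgrp a).

Inductive h_eta_gen : daha -> Prop :=
| Heta_eta i : h_eta_gen (deta i)
| Heta_grp a : h_eta_gen (dgrp a).

Definition h_eta := subalg h_eta_gen.
HB.instance Definition _ := GRing.SubPzRing.on h_eta.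

Definition heta_eta (i : 'I_n) : h_eta := subalg_gen (Heta_eta i).
Definition heta_grp (a : signed_perm n) : h_eta := subalg_gen (Heta_grp a).

(* The scalars c act on V through c *: 1 in h_eta, and v0 is a basis of V. *)
Definition is_trivial_module (V : lmodType h_eta) (v0 : V) : Prop :=
  [/\ forall w : V, exists! c : K, w = subalg_scalar h_eta_gen c *: v0,
      forall (a : signed_perm n) (w : V), heta_grp a *: w = w
    & forall (i : 'I_n) (w : V), heta_eta i *: w = 0].

Definition skew_to_daha : skewpoly K n -> daha := pres_map dxi.

Lemma dxi_rel a b : skew_relation a b -> feval dxi a = feval dxi b.
Proof.
case=> i j ij; rewrite fevalN !fevalM !feval_gen /dxi /pgen -!ppiM -ppiN.
exact/pres_rel/Daha_xi.
Qed.

Lemma skew_to_daha_xi j : skew_to_daha (xi j) = dxi j.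
Proof. exact: (pres_map_gen dxi_rel). Qed.

Lemma skew_to_daha_morph :
  [/\ skew_to_daha 1 = 1, {morph skew_to_daha : f g / f * g}
    & linear skew_to_daha].
Proof. exact: (pres_map_morph dxi_rel). Qed.

Definition skew_to_ind (V : lmodType h_eta) (v0 : V) (f : skewpoly K n) :
    ind_module V :=
  tens (skew_to_daha f) v0.

End OddDAHA.

(* Main.v *)
Require Import Defs.
From HB Require Import structures.
From mathcomp Require Import all_boot all_order all_fingroup all_algebra.
From mathcomp Require Import monalg.
From mathcomp Require Import boolp classical_sets reals.
From mathcomp Require Import complex.

Set Implicit Arguments.
Unset Strict Implicit.
Unset Printing Implicit Defensive.

Import GRing.Theory.
Local Open Scope ring_scope.

(** In the induced module, eta_i kills the generating vector v0, and its action on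
    a word in the xi_j applied to v0 is found by moving eta_i to the right through
    the word, using the anticommutators of eta_i with the xi_j.  The operator of
    the theorem kills 1 and has the same anticommutators with the xi_j, so the two
    agree.  That the words give a copy of the skew polynomials rests on three
    facts.

    First, the operators of the theorem obey simple Leibniz rules.  The operator
    (1 - tau_i)/(2 xi_i) is the super derivation dual to xi_i
    ([superder_sign]).  The divided difference Q_ik, the
    quotient of (xi_i - xi_k) s_ik - (xi_i tau_i - xi_k tau_k) by
    xi_i^2 - xi_k^2, kills 1, anticommutes with xi_j for j distinct from i
    and k, and has anticommutator s_ik with xi_i and with xi_k
    ([dunkl_quot_xi]).  Existence of the quotient is an induction on words,
    because this rule exhibits the quotient for xi_j f from that for f.
    Uniqueness needs xi_i and xi_i^2 - xi_k^2 to be left regular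
    ([xi_lreg], [xi2_diff_lreg]).

    Second, the resulting operators D_i satisfy all relations of the double
    affine Hecke algebra ([skew_act_rel]).  The relations between eta and xi are
    the Leibniz rule [dunkl_xi]; the anticommutation of the D_i holds because
    D_i D_j + D_j D_i commutes with every xi_k and kills 1
    ([dunkl_anticomm]).  Hence the algebra acts on skew polynomials, and the
    line of constants is a trivial module for the subalgebra of the eta_i and W.

    Third, this representation gives a map from the induced module back to skew
    polynomials, a (x) c v0 |-> c (a . 1), which commutes with the algebra and is
    a left inverse of f |-> f (x) v0 ([skew_to_indK]).  The latter map is onto
    since its image is stable under the generators ([ind_to_skewK]).  Both maps
    are therefore bijective, and the action on the induced module is the
    representation by Dunkl operators ([skew_to_ind_act]). *)

(** * Presented algebras: induction on words and modules *)

Section PresentedAlgebra.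

Variables (K : comNzRingType) (I : choiceType).
Variable r : freealg K I -> freealg K I -> Prop.

Lemma ppi_word (w : seq I) :
  ppi r << FMonom w >> = \prod_(i <- w) pgen r i.
Proof.
elim: w => [|i w IH]; first by rewrite big_nil -fmoneE.
rewrite big_cons -IH /pgen -ppiM; congr ppi.
rewrite /fgen -lock [_ * _]fmulE malgM_def fgmulUU mulr1.
by congr (mkmalgU _ _); apply: val_inj; rewrite /= fmM fmU.
Qed.

Lemma pres_word_ind (P : pres r -> Prop) :
    (forall c a b, P a -> P b -> P (c *: a + b)) ->
    (forall w : seq I, P (\prod_(i <- w) pgen r i)) ->
  forall a, P a.
Proof.
move=> Plin Pw a; rewrite -[a]ppiK [prepr a](monalgE (prepr a : {malg K[{fmonom I}]})).
elim: (finmap.enum_fset _) => [|w s IH].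
  by rewrite big_nil ppi0 -(addNr 1) -scaleN1r; have := Pw [::]; rewrite big_nil; auto.
rewrite big_cons ppiD; move: IH; set b := ppi r (\sum_(_ <- _) _) => IH.
have -> : << (prepr a : {malg K[{fmonom I}]})@_w *g w >>
    = (prepr a : {malg K[{fmonom I}]})@_w *: (<< FMonom w >> : freealg K I).
  case: w => w; apply/malgP => w'.
  by rewrite [RHS]mcoeffZ !mcoeffU mulrnAr mulr1.
by rewrite ppiZ ppi_word; apply: Plin.
Qed.

Lemma pres_ind (P : pres r -> Prop) :
    (forall c a b, P a -> P b -> P (c *: a + b)) -> P 1 ->
    (forall i a, P a -> P (pgen r i * a)) ->
  forall a, P a.
Proof.
move=> Plin P1 PM; apply: pres_word_ind => // w.
by elim: w => [|i w IH]; rewrite ?big_nil ?big_cons //; exact: PM.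
Qed.

Variables (M : lmodType K) (A : I -> M -> M).
Hypothesis A_lin : forall i, linear (A i).
Hypothesis A_rel : forall a b, r a b -> forall x, frep A a x = frep A b x.

Definition pres_act (a : pres r) (x : M) : M := frep A (prepr a) x.

Lemma pres_act_ppi p x : pres_act (ppi r p) x = frep A p x.
Proof. exact: (frep_ideal A_lin A_rel (ppiK (ppi r p))). Qed.

Lemma pres_act_gen i x : pres_act (pgen r i) x = A i x.
Proof. by rewrite pres_act_ppi frep_gen. Qed.

Lemma pres_actM a b x : pres_act (a * b) x = pres_act a (pres_act b x).
Proof.
by rewrite -[a]ppiK -[b]ppiK -ppiM !pres_act_ppi frepM.
Qed.

Lemma pres_act1 x : pres_act 1 x = x.
Proof. by rewrite -ppi1 pres_act_ppi frep1. Qed.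

Lemma pres_act_linl c a b x : pres_act (c *: a + b) x = c *: pres_act a x + pres_act b x.
Proof.
by rewrite -[a]ppiK -[b]ppiK -ppiZ -ppiD !pres_act_ppi frepD // frepZl.
Qed.

Lemma pres_act_linr a : linear (pres_act a).
Proof. exact: frep_linear. Qed.

End PresentedAlgebra.

Section FreeRepresentation.

Variables (K : comNzRingType) (I : choiceType) (M : lmodType K) (A : I -> M -> M).

Lemma frepN p x : frep A (- p) x = - frep A p x.
Proof. by rewrite -[- p]sub0r frepB frep0 sub0r. Qed.

Lemma frep_suml (J : Type) (s : seq J) (P : pred J) (F : J -> freealg K I) x :
  frep A (\sum_(j <- s | P j) F j) x = \sum_(j <- s | P j) frep A (F j) x.
Proof. exact: (big_morph (frep A ^~ x) (frepD A x) (frep0 A x)). Qed.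

End FreeRepresentation.

(** * Operators on skew polynomials *)

Section SkewOperators.

Variables (K : comNzRingType) (n : nat).
Local Notation S := (skewpoly K n).
Implicit Types (f g : S) (i j k : 'I_n).

HB.instance Definition _ s :=
  GRing.isLinear.Build K S S _ (@skew_perm K n s)
    (let: And3 _ _ h := skew_perm_morph K s in h).
HB.instance Definition _ i :=
  GRing.isLinear.Build K S S _ (@skew_sign K n i)
    (let: And3 _ _ h := skew_sign_morph K i in h).
HB.instance Definition _ i :=
  GRing.isLinear.Build K S S _ (@superder K n i) (@sder_linear K n i).

Lemma skew_perm_1 s : skew_perm s (1 : S) = 1.
Proof. by case: (skew_perm_morph K s). Qed.

Lemma skew_permM s : {morph @skew_perm K n s : f g / f * g}.
Proof. by case: (skew_perm_morph K s). Qed.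

Lemma skew_sign_1 i : skew_sign i (1 : S) = 1.
Proof. by case: (skew_sign_morph K i). Qed.

Lemma skew_signM i : {morph @skew_sign K n i : f g / f * g}.
Proof. by case: (skew_sign_morph K i). Qed.

Lemma skew_ind (P : S -> Prop) :
    (forall c f g, P f -> P g -> P (c *: f + g)) -> P 1 ->
    (forall i f, P f -> P (xi i * f)) ->
  forall f, P f.
Proof. exact: pres_ind. Qed.

Lemma scale_mulr (c : K) f g : f * (c *: g) = c *: (f * g).
Proof. by rewrite [RHS]pres_scalerAr. Qed.

Lemma xi_anticommM i j f : i != j -> xi i * (xi j * f) = - (xi j * (xi i * f)).
Proof. by move=> ij; rewrite !mulrA xi_anticomm // mulNr. Qed.

Lemma skew_perm_comp s s' f :
  skew_perm s (skew_perm s' f) = skew_perm (s' * s)%g f.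
Proof.
elim/skew_ind: f => [c f g Hf Hg||j f Hf]; rewrite ?skew_perm_1 //.
  by rewrite !linearP /= Hf Hg.
by rewrite !skew_permM Hf !skew_perm_xi permM.
Qed.

Lemma skew_perm_id f : skew_perm 1%g f = f.
Proof.
elim/skew_ind: f => [c f g Hf Hg||j f Hf]; rewrite ?skew_perm_1 //.
  by rewrite !linearP /= Hf Hg.
by rewrite skew_permM Hf skew_perm_xi perm1.
Qed.

Lemma superder1 i : superder i (1 : S) = 0.
Proof.
have -> : (1 : S) = xi_word K [::] by rewrite /xi_word big_nil.
by rewrite sder_xi_word /sder_word big_ord0.
Qed.

(** Both sides are linear in f, so it suffices to treat words, where the rule is
    the recursion for the super derivation. *)
Lemma superder_xi i j f :
  superder i (xi j * f) = (j == i)%:R * f - xi j * superder i f.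
Proof.
elim/pres_word_ind: f => [c f g Hf Hg|w].
  rewrite [xi j * _]mulrDr [xi j * (c *: f)]scale_mulr linearP /= Hf Hg.
  rewrite linearP /= scalerBr -scale_mulr addrACA -mulrDr -opprD.
  by rewrite -[c *: (xi j * _)]scale_mulr -mulrDr.
rewrite -[\prod_(_ <- _) _]/(xi_word K w) sder_xi_word -sder_word_cons -sder_xi_word.
by rewrite {2}/xi_word big_cons.
Qed.

(** The second component carries the operator that removes a leading xi_i,
    annihilates 1 and anticommutes with the other xi_j, namely the twisted
    derivation at i with parameter q = 0 (q = -1 is the super derivation).  The
    first component remembers the polynomial to which it is applied. *)
Definition xi_linv_pair i j (x : S * S) : S * S :=
  (xi j * x.1, if j == i then x.1 else - (xi j * x.2)).

Lemma xi_linv_pair_linear i j : linear (xi_linv_pair i j).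
Proof.
move=> c [x1 x2] [y1 y2]; congr (_, _) => /=; first by rewrite mulrDr scale_mulr.
by case: eqP => // _; rewrite mulrDr scale_mulr opprD scalerN.
Qed.

Lemma xi_linv_pair_rel i a b : skew_relation a b ->
  forall x, frep (xi_linv_pair i) a x = frep (xi_linv_pair i) b x.
Proof.
have lin := xi_linv_pair_linear i.
case=> j k jk [x y]; rewrite -[- _]sub0r frepB frep0 !(frepM lin) !frep_gen.
rewrite sub0r /xi_linv_pair /=; congr (_, _) => /=; first exact: xi_anticommM.
have [<-|ji] := eqVneq j i; first by rewrite eq_sym (negPf jk) opprK.
by have [//|ki] := eqVneq k i; rewrite !mulrN !opprK xi_anticommM // opprK.
Qed.

Definition xi_linv i f : S := (pres_act (xi_linv_pair i) f (1, 0)).2.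

Lemma xi_linv_act i f : pres_act (xi_linv_pair i) f (1, 0) = (f, xi_linv i f).
Proof.
rewrite [LHS]surjective_pairing; congr (_, _).
elim/skew_ind: f => [c f g Hf Hg||j f Hf].
- rewrite pres_act_linl ?{1}Hf ?Hg /= ?Hf ?Hg //; last exact: xi_linv_pair_rel.
  exact: xi_linv_pair_linear.
- rewrite pres_act1 //; last exact: xi_linv_pair_rel.
  exact: xi_linv_pair_linear.
- rewrite pres_actM; [|exact: xi_linv_pair_linear|exact: xi_linv_pair_rel].
  rewrite pres_act_gen; [|exact: xi_linv_pair_linear|exact: xi_linv_pair_rel].
  by rewrite /= Hf.
Qed.

Lemma xi_linv_linear i : linear (xi_linv i).
Proof.
move=> c f g; rewrite {1}/xi_linv pres_act_linl //; last exact: xi_linv_pair_rel.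
exact: xi_linv_pair_linear.
Qed.
HB.instance Definition _ i := GRing.isLinear.Build K S S _ (xi_linv i) (xi_linv_linear i).

Lemma xi_linv1 i : xi_linv i 1 = 0.
Proof.
rewrite /xi_linv pres_act1 //; last exact: xi_linv_pair_rel.
exact: xi_linv_pair_linear.
Qed.

Lemma xi_linv_xi i j f :
  xi_linv i (xi j * f) = if j == i then f else - (xi j * xi_linv i f).
Proof.
rewrite {1}/xi_linv pres_actM; [|exact: xi_linv_pair_linear|exact: xi_linv_pair_rel].
rewrite pres_act_gen; [|exact: xi_linv_pair_linear|exact: xi_linv_pair_rel].
by rewrite xi_linv_act.
Qed.

(** Cancelling xi_i by an explicit left inverse avoids a monomial basis of the
    skew-polynomial algebra. *)
Lemma xi_linvK i : cancel ( *%R (xi i)) (xi_linv i).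
Proof. by move=> f; rewrite xi_linv_xi eqxx. Qed.

Lemma iter_xi_linv_le i f m m' :
  (m <= m')%N -> iter m (xi_linv i) f = 0 -> iter m' (xi_linv i) f = 0.
Proof.
move=> /subnK <- H; rewrite iterD H.
by elim: (m' - m)%N => //= p ->; rewrite linear0.
Qed.

(** Up to sign, the left inverse removes the first letter xi_i of a word, and it
    kills a word without such a letter; so a word with m letters xi_i dies after
    m + 1 steps. *)
Lemma xi_linv_nilp i f : exists m, iter m (xi_linv i) f = 0.
Proof.
elim/skew_ind: f => [c f g [m Hf] [p Hg]||j f [m Hf]].
- exists (maxn m p).
  have -> q : iter q (xi_linv i) (c *: f + g) =
      c *: iter q (xi_linv i) f + iter q (xi_linv i) g.
    by elim: q => //= q ->; rewrite linearP.
  rewrite (iter_xi_linv_le _ Hf) ?leq_maxl // (iter_xi_linv_le _ Hg) ?leq_maxr //.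
  by rewrite scaler0 addr0.
- by exists 1%N; rewrite /= xi_linv1.
- have [->|ji] := eqVneq j i; first by exists m.+1; rewrite iterSr xi_linvK.
  exists m; suff -> q : iter q (xi_linv i) (xi j * f) =
      (-1) ^+ q *: (xi j * iter q (xi_linv i) f) by rewrite Hf mulr0 scaler0.
  elim: q => [|q IH] /=; first by rewrite scale1r.
  by rewrite IH linearZ /= xi_linv_xi (negPf ji) exprS mulN1r scaleNr scalerN.
Qed.

Lemma xi_lreg i f g : xi i * f = xi i * g -> f = g.
Proof. exact: (can_inj (xi_linvK i)). Qed.

(** Let L be the left inverse of xi_i.  If xi_i^2 h = xi_k^2 h then applying
    L^2, which commutes with xi_k^2, gives h = xi_k^2 L^2 h.  Iterating,
    h = xi_k^(2m) L^(2m) h, and this vanishes for large m since L is locally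
    nilpotent. *)
Lemma xi2_diff_lreg i k f g : k != i ->
  (xi i ^+ 2 - xi k ^+ 2) * f = (xi i ^+ 2 - xi k ^+ 2) * g -> f = g.
Proof.
move=> ki /eqP; rewrite -subr_eq0 -mulrBr => /eqP H; apply/eqP.
rewrite -subr_eq0; apply/eqP; move: {f g}(f - g) H => h.
rewrite mulrBl => /eqP; rewrite subr_eq0 => /eqP H.
have E f : xi_linv i (xi_linv i (xi k ^+ 2 * f)) = xi k ^+ 2 * xi_linv i (xi_linv i f).
  have sk g : xi_linv i (xi k * g) = - (xi k * xi_linv i g).
    by rewrite xi_linv_xi (negPf ki).
  by rewrite expr2 -!mulrA !sk mulrN opprK !sk mulrN opprK.
have H1 : h = xi k ^+ 2 * xi_linv i (xi_linv i h).
  by rewrite -E -H expr2 -mulrA !xi_linvK.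
have E2 m f : iter (m * 2) (xi_linv i) (xi k ^+ 2 * f)
    = xi k ^+ 2 * iter (m * 2) (xi_linv i) f.
  by elim: m => // m IH; rewrite mulSn !iterD IH; exact: E.
have [m Hm] := xi_linv_nilp i h.
suff -> : h = xi k ^+ (m * 2) * iter (m * 2) (xi_linv i) h.
  by rewrite (iter_xi_linv_le _ Hm) ?mulr0 ?leq_pmulr.
elim: m {Hm} => [|m IH]; first by rewrite mul0n expr0 mul1r.
rewrite {1}IH {1}H1 E2 mulrA -exprD -!iterSr.
by rewrite mulSn addnC.
Qed.

End SkewOperators.

(** * Dunkl operators and their Leibniz rules *)

Section Dunkl.

Variables (K : fieldType) (n : nat).
Hypothesis two_neq0 : 2%:R != 0 :> K.
Local Notation S := (skewpoly K n).
Implicit Types (f g : S) (i j k : 'I_n).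

Lemma two_mul f : 2%:R * f = 2%:R *: f.
Proof. by rewrite mulr_natl scaler_nat. Qed.

Lemma skew_ldivP (d f g : S) :
  (forall g1 g2, d * g1 = d * g2 -> g1 = g2) -> d * g = f -> skew_ldiv d f = g.
Proof.
move=> dreg dg; apply: xget_unique => [//|g' dg'].
by apply: dreg; rewrite dg.
Qed.

Lemma xi_double_lreg i f g : (2%:R * xi i) * f = (2%:R * xi i) * g -> f = g.
Proof.
rewrite -![2%:R * xi i * _]mulrA !two_mul => /(scalerI two_neq0).
exact: xi_lreg.
Qed.

(** The operator (1 - tau_i)/(2 xi_i) obeys the Leibniz rule of the super
    derivation, so the t and v terms of the Dunkl operator are proportional. *)
Lemma superder_sign i f : (2%:R * xi i) * superder i f = f - skew_sign i f.
Proof.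
elim/skew_ind: f => [c f g Hf Hg||j f Hf].
- rewrite !linearP /= mulrDr scale_mulr Hf Hg scalerBr addrACA.
  by rewrite scalerN.
- by rewrite superder1 mulr0 skew_sign_1 subrr.
rewrite superder_xi skew_signM skew_sign_xi.
move: Hf; rewrite -!mulrA !two_mul => Hf.
have [->|ji] := eqVneq j i.
  rewrite mul1r mulNr opprK mulrBr scalerBr -[2%:R *: (xi i * (xi i * _))]scale_mulr.
  by rewrite Hf mulrBr scaler_nat mulr2n opprB addrACA subrr addr0.
rewrite mul0r sub0r mulrN xi_anticommM 1?eq_sym // opprK.
by rewrite -scale_mulr Hf mulrBr.
Qed.

Lemma skew_ldiv_sign i f :
  skew_ldiv (2%:R * xi i) (f - skew_sign i f) = superder i f.
Proof. apply: skew_ldivP; [exact: xi_double_lreg | exact: superder_sign]. Qed.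

Lemma dunkl_num_linear i k : linear (@dunkl_num K n i k).
Proof.
have E c (a b a' b' : S) : c *: a + b - (c *: a' + b') = c *: (a - a') + (b - b').
  by rewrite scalerBr opprD addrACA.
by move=> c f g; rewrite /dunkl_num !linearP /= !mulrDr !scale_mulr !E.
Qed.
HB.instance Definition _ i k :=
  GRing.isLinear.Build K S S _ (@dunkl_num K n i k) (@dunkl_num_linear i k).

Lemma dunkl_num1 i k : dunkl_num i k (1 : S) = 0.
Proof. by rewrite /dunkl_num skew_perm_1 !skew_sign_1 !mulr1 subrr. Qed.

Lemma dunkl_numC i k f : dunkl_num k i f = - dunkl_num i k f.
Proof.
by rewrite /dunkl_num tpermC -[xi k - xi i]opprB mulNr !opprB addrC.
Qed.

Lemma dunkl_num_xi_other i k j f : j != i -> j != k ->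
  dunkl_num i k (xi j * f) = - (xi j * dunkl_num i k f).
Proof.
move=> ji jk; rewrite /dunkl_num skew_permM !skew_signM skew_perm_xi.
rewrite !skew_sign_xi (negPf ji) (negPf jk) tpermD 1?eq_sym //.
rewrite eq_sym in ji; rewrite eq_sym in jk.
rewrite !mulrBl !(xi_anticommM _ ji) !(xi_anticommM _ jk).
by rewrite !mulrBr !opprD.
Qed.

(** After expansion, s_ik turns xi_i into xi_k and tau_i changes its sign; the
    mixed and the tau terms cancel because xi_k xi_i = - xi_i xi_k. *)
Lemma dunkl_num_xi_fst i k f : k != i ->
  dunkl_num i k (xi i * f) + xi i * dunkl_num i k f
    = (xi i ^+ 2 - xi k ^+ 2) * skew_perm (tperm i k) f.
Proof.
move=> ki; rewrite /dunkl_num skew_permM !skew_signM skew_perm_xi tpermL.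
rewrite !skew_sign_xi eqxx [i == k]eq_sym (negPf ki) !expr2 mulNr mulrN.
rewrite !mulrBr !mulrBl !mulrBr !(xi_anticommM _ ki) -!mulrA.
set a := xi i * (xi i * skew_perm _ _); set b := xi i * (xi k * skew_perm _ _).
set c := xi k * (xi k * _); set d := xi i * (xi i * skew_sign _ _).
set e := xi i * (xi k * skew_sign _ _).
by rewrite -opprD opprK addrACA subrr addr0 addrC addrA subrK.
Qed.

Lemma dunkl_num_xi_snd i k f : k != i ->
  dunkl_num i k (xi k * f) + xi k * dunkl_num i k f
    = (xi i ^+ 2 - xi k ^+ 2) * skew_perm (tperm i k) f.
Proof.
move=> ki; rewrite -[LHS]opprK opprD -mulrN -!dunkl_numC.
by rewrite dunkl_num_xi_fst 1?eq_sym // tpermC -mulNr opprB.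
Qed.

Lemma dunkl_num_xi i k j f : k != i ->
  dunkl_num i k (xi j * f) + xi j * dunkl_num i k f =
  (xi i ^+ 2 - xi k ^+ 2) *
    (((j == i) || (j == k))%:R *: skew_perm (tperm i k) f).
Proof.
move=> ki; have [->|ji] := eqVneq j i; first by rewrite scale1r dunkl_num_xi_fst.
have [->|jk] := eqVneq j k; first by rewrite scale1r dunkl_num_xi_snd.
by rewrite dunkl_num_xi_other // addNr scale0r mulr0.
Qed.

Lemma xi2_diff_central i k j f :
  (xi i ^+ 2 - xi k ^+ 2) * (xi j * f) = xi j * ((xi i ^+ 2 - xi k ^+ 2) * f).
Proof.
have H a : xi a ^+ 2 * (xi j * f) = xi j * (xi a ^+ 2 * f).
  rewrite expr2 -!mulrA; have [->//|aj] := eqVneq a j.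
  by rewrite (xi_anticommM _ aj) mulrN (xi_anticommM _ aj) opprK.
by rewrite !mulrBl !H mulrBr.
Qed.

(** The Leibniz rule of the numerator writes the quotient for xi_j f in terms of
    the quotient for f, the denominator being central. *)
Lemma dunkl_num_div i k f : k != i ->
  exists g, (xi i ^+ 2 - xi k ^+ 2) * g = dunkl_num i k f.
Proof.
move=> ki; elim/skew_ind: f => [c f f' [g Hg] [g' Hg']||j f [g Hg]].
- by exists (c *: g + g'); rewrite mulrDr scale_mulr Hg Hg' linearP.
- by exists 0; rewrite mulr0 dunkl_num1.
- exists (((j == i) || (j == k))%:R *: skew_perm (tperm i k) f - xi j * g).
  by rewrite mulrBr -dunkl_num_xi // xi2_diff_central Hg addrK.
Qed.

Definition dunkl_quot i k f : S := skew_ldiv (xi i ^+ 2 - xi k ^+ 2) (dunkl_num i k f).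

Lemma dunkl_quotE i k f : k != i ->
  (xi i ^+ 2 - xi k ^+ 2) * dunkl_quot i k f = dunkl_num i k f.
Proof.
move=> ki; have [g Hg] := dunkl_num_div f ki.
by rewrite /dunkl_quot (skew_ldivP _ Hg) // => g1 g2; exact: xi2_diff_lreg.
Qed.

Lemma dunkl_quot_linear i k : k != i -> linear (dunkl_quot i k).
Proof.
move=> ki c f g; apply: (xi2_diff_lreg ki).
by rewrite dunkl_quotE // linearP /= mulrDr scale_mulr !dunkl_quotE.
Qed.

Lemma dunkl_quot1 i k : k != i -> dunkl_quot i k 1 = 0.
Proof.
by move=> ki; apply: (xi2_diff_lreg ki); rewrite dunkl_quotE // dunkl_num1 mulr0.
Qed.

Lemma dunkl_quot_xi i k j f : k != i ->
  dunkl_quot i k (xi j * f) =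
    ((j == i) || (j == k))%:R *: skew_perm (tperm i k) f - xi j * dunkl_quot i k f.
Proof.
move=> ki; apply: (xi2_diff_lreg ki).
by rewrite mulrBr -dunkl_num_xi // xi2_diff_central !dunkl_quotE // addrK.
Qed.

Variables t u v : K.
Local Notation D := (dunkl t u v).

Lemma dunklE i f : D i f = (t + v) *: superder i f
  + (2%:R * u) *: \sum_(k < n | k != i) dunkl_quot i k f.
Proof.
rewrite /dunkl skew_ldiv_sign scalerDl; congr (_ + _).
rewrite mulrC -scalerA; congr (_ *: _); rewrite scaler_sumr.
by apply: eq_bigr => k _; rewrite two_mul.
Qed.

Lemma dunkl_linear i : linear (D i).
Proof.
move=> c f g; rewrite !dunklE linearP /=.
have -> : \sum_(k < n | k != i) dunkl_quot i k (c *: f + g) =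
    c *: (\sum_(k < n | k != i) dunkl_quot i k f)
    + \sum_(k < n | k != i) dunkl_quot i k g.
  by rewrite scaler_sumr -big_split /=; apply: eq_bigr => k ki; rewrite dunkl_quot_linear.
by rewrite !scalerDr addrACA !scalerA ![_ * c]mulrC.
Qed.
HB.instance Definition _ i := GRing.isLinear.Build K S S _ (D i) (dunkl_linear i).

Lemma dunkl1 i : D i 1 = 0.
Proof.
by rewrite dunklE superder1 big1 ?scaler0 ?addr0 // => k; exact: dunkl_quot1.
Qed.

(** The action of the anticommutator of eta_i and xi_j on skew polynomials: the
    elements s_ik and sbar_ik of W both act as the transposition, whence the
    factor 2, and tau_i acts as the identity. *)
Definition eta_xi i j f : S :=
  if j == i then (t + v) *: f + (2%:R * u) *: \sum_(k < n | k != i) skew_perm (tperm i k) f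
  else (2%:R * u) *: skew_perm (tperm i j) f.

Lemma dunkl_xi i j f : D i (xi j * f) = eta_xi i j f - xi j * D i f.
Proof.
rewrite !dunklE superder_xi mulrDr opprD !scale_mulr scalerBr.
rewrite [xi j * \sum_(k < n | _) _]mulr_sumr.
rewrite (eq_bigr _ (fun k ki => dunkl_quot_xi j f ki)).
rewrite sumrB scalerBr addrACA; congr (_ + _); rewrite /eta_xi.
have [->|ji] := eqVneq j i.
  by rewrite mul1r; under eq_bigr do rewrite scale1r.
rewrite mul0r scaler0 add0r; congr (_ *: _).
rewrite (bigD1 j) //= eqxx scale1r big1 ?addr0 // => k /andP[_ kj].
by rewrite eq_sym (negPf kj) scale0r.
Qed.

Lemma eta_xi_equivariant s i j f :
  skew_perm s (eta_xi i j f) = eta_xi (s i) (s j) (skew_perm s f).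
Proof.
have H a b : skew_perm s (skew_perm (tperm a b) f) =
    skew_perm (tperm (s a) (s b)) (skew_perm s f).
  by rewrite !skew_perm_comp -tpermJ conjgC.
rewrite /eta_xi (inj_eq perm_inj); case: eqP => _; last by rewrite linearZ /= H.
rewrite linearD !linearZ /=
  [skew_perm s (\sum_(k < n | _) _)]linear_sum; congr (_ + _ *: _).
rewrite [RHS](reindex_inj (@perm_inj _ s)) /=.
by apply: eq_big => k; rewrite ?(inj_eq perm_inj) // => _; exact: H.
Qed.

Lemma dunkl_equivariant s i f : skew_perm s (D i f) = D (s i) (skew_perm s f).
Proof.
elim/skew_ind: f => [c f g Hf Hg||j f Hf].
- by rewrite !linearP /= Hf Hg.
- by rewrite skew_perm_1 !dunkl1 linear0.
- rewrite skew_permM skew_perm_xi !dunkl_xi linearB /= eta_xi_equivariant.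
  by rewrite skew_permM skew_perm_xi Hf.
Qed.

(** With X_ij the anticommutator of eta_i and xi_j, this says
    [D_i, X_jk] + [D_j, X_ik] = 0, hence that D_i D_j + D_j D_i commutes with
    xi_k.  For k = i it holds because s_ij exchanges D_i and D_j, and every other
    s_il commutes with D_j. *)
Lemma eta_xi_jacobi i j k f : i != j ->
  D i (eta_xi j k f) + D j (eta_xi i k f) =
  eta_xi j k (D i f) + eta_xi i k (D j f).
Proof.
wlog kj : i j / k != j => [H ij|ij].
  have [kj|kj] := eqVneq k j; last exact: H.
  by rewrite addrC [RHS]addrC; apply: H; rewrite ?kj eq_sym.
rewrite /eta_xi (negPf kj).
have [->|ki] := eqVneq k i; last first.
  by rewrite !linearZ /= !dunkl_equivariant !tpermD // eq_sym.
rewrite [X in _ + X]linearD /= !linearZ /=.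
rewrite [D j (\sum_(k < n | _) _)]linear_sum /=.
rewrite [_ + (_ + _)]addrCA [RHS]addrCA; congr (_ + _).
rewrite -!scalerDr; congr (_ *: _).
rewrite !(bigD1 (P := fun k => k != i) j) 1?eq_sym //= addrA [RHS]addrA.
congr (_ + _); last first.
  apply: eq_bigr => l /andP[li lj].
  by rewrite dunkl_equivariant tpermD // eq_sym.
by rewrite !dunkl_equivariant tpermC tpermL tpermR addrC.
Qed.

(** An operator that commutes with all xi_k and kills 1 vanishes, and
    D_i D_j + D_j D_i is such an operator. *)
Lemma dunkl_anticomm i j f : i != j -> D i (D j f) = - D j (D i f).
Proof.
move=> ij; elim/skew_ind: f => [c f g Hf Hg||k f Hf].
- by rewrite !dunkl_linear Hf Hg scalerN -opprD.
- by rewrite !dunkl1 ![D _ 0]linear0 oppr0.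
have H : D i (eta_xi j k f) - eta_xi i k (D j f) =
    eta_xi j k (D i f) - D j (eta_xi i k f).
  apply/eqP; rewrite subr_eq addrAC eq_sym subr_eq; apply/eqP.
  by rewrite eta_xi_jacobi.
rewrite !dunkl_xi !linearB /= !dunkl_xi Hf mulrN opprK opprD addrA H.
by rewrite opprK [RHS]addrCA addrA.
Qed.

End Dunkl.

(** * The polynomial representation *)

Section PolynomialRepresentation.

Variables (K : fieldType) (n : nat).
Hypothesis two_neq0 : 2%:R != 0 :> K.
Variables t u v : K.
Local Notation S := (skewpoly K n).
Local Notation H := (daha n t u v).
Local Notation B := (h_eta n t u v).
Local Notation D := (dunkl t u v).

Definition skew_act (g : dgen n) : S -> S :=
  match g with
  | Dxi i => fun f => xi i * f
  | Deta i => D i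
  | Dgrp s => skew_perm (forget s)
  end.

Lemma skew_act_linear g : linear (skew_act g).
Proof.
case: g => [i|i|s] c f g /=; last exact: linearP.
- by rewrite mulrDr scale_mulr.
- exact: dunkl_linear.
Qed.

Lemma skew_act_rel a b : daha_relation t u v a b ->
  forall f, frep skew_act a f = frep skew_act b f.
Proof.
have lin := skew_act_linear.
case=> [|a' b'|i j ij|i j ij|a' j|a' j|i j ij|i] f;
  rewrite ?frepN ?frepD ?(frepM lin) ?frep_gen ?(frepZl lin) ?frepD ?frep_gen ?frep1 /=.
- exact: skew_perm_id.
- exact: skew_perm_comp.
- exact: dunkl_anticomm.
- exact: xi_anticommM.
- by rewrite skew_permM skew_perm_xi.
- exact: dunkl_equivariant.
- rewrite dunkl_xi // /eta_xi eq_sym (negPf ij) subrK.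
  by rewrite -mulr2n -scaler_nat scalerA mulrC.
- rewrite dunkl_xi // /eta_xi eqxx subrK frep_suml.
  rewrite scalerDl addrAC skew_perm_id mulrC -scalerA; congr (_ + _ + _).
  rewrite scaler_sumr; congr (_ *: _); apply: eq_bigr => k _.
  by rewrite frepD !frep_gen /= tpermC scaler_nat mulr2n.
Qed.

Definition daha_act : H -> S -> S := pres_act skew_act.

Lemma daha_act_gen g f : daha_act (pgen _ g) f = skew_act g f.
Proof. exact: (pres_act_gen skew_act_linear skew_act_rel). Qed.

Lemma daha_actM a b f : daha_act (a * b) f = daha_act a (daha_act b f).
Proof. exact: (pres_actM skew_act_linear skew_act_rel). Qed.

Lemma daha_act1 f : daha_act 1 f = f.
Proof. exact: (pres_act1 skew_act_linear skew_act_rel). Qed.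

Lemma daha_act_linl c a b f : daha_act (c *: a + b) f = c *: daha_act a f + daha_act b f.
Proof. exact: (pres_act_linl skew_act_linear skew_act_rel). Qed.

Lemma daha_act_linr a : linear (daha_act a).
Proof. exact: (pres_act_linr skew_act_linear). Qed.

Lemma daha_actD a b f : daha_act (a + b) f = daha_act a f + daha_act b f.
Proof. by rewrite -[a in LHS]scale1r daha_act_linl scale1r. Qed.

Lemma daha_actZr a c f : daha_act a (c *: f) = c *: daha_act a f.
Proof.
have E : daha_act a 0 = 0.
  by have := daha_act_linr a (-1) 0 0; rewrite scaler0 addr0 scaleN1r addNr.
by rewrite -[c *: f]addr0 daha_act_linr E addr0.
Qed.

Lemma daha_act_scalar c f : daha_act (c *: (1 : H)) f = c *: f.
Proof.
have E : daha_act 0 f = 0.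
  by have := daha_act_linl (-1) 0 0 f; rewrite scaler0 addr0 scaleN1r addNr.
by rewrite -[c *: (1 : H)]addr0 daha_act_linl daha_act1 E addr0.
Qed.

Lemma skew_to_daha_xiM i f :
  skew_to_daha (n := n) t u v (xi i * f) = dxi t u v i * skew_to_daha (n := n) t u v f.
Proof.
by case: (skew_to_daha_morph n t u v) => _ -> _; rewrite skew_to_daha_xi.
Qed.

Lemma daha_act_skew f : daha_act (skew_to_daha (n := n) t u v f) 1 = f.
Proof.
have [E1 _ El] := skew_to_daha_morph n t u v.
elim/skew_ind: f => [c f g Hf Hg||i f Hf].
- by rewrite El daha_act_linl Hf Hg.
- by rewrite E1 daha_act1.
- by rewrite skew_to_daha_xiM daha_actM Hf daha_act_gen.
Qed.

Definition const_term_act (i : 'I_n) (x : K^o) : K^o := 0.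

Lemma const_term_act_linear i : linear (const_term_act i).
Proof. by move=> c x y; rewrite /const_term_act scaler0 addr0. Qed.

Lemma const_term_act_rel a b : skew_relation a b ->
  forall x, frep const_term_act a x = frep const_term_act b x.
Proof.
case=> i j _ x; have lin := const_term_act_linear.
by rewrite frepN !(frepM lin) !frep_gen oppr0.
Qed.

Definition const_term (f : S) : K := pres_act const_term_act f 1.

Lemma const_term1 : const_term 1 = 1.
Proof. exact: (pres_act1 const_term_act_linear const_term_act_rel). Qed.

Lemma const_termP c f g : const_term (c *: f + g) = c * const_term f + const_term g.
Proof. exact: (pres_act_linl const_term_act_linear const_term_act_rel). Qed.

Lemma const_termZ1 c : const_term (c *: (1 : S)) = c.
Proof.
have E : const_term 0 = 0.
  by have := const_termP (-1) 0 0; rewrite scaler0 addr0 mulN1r addNr.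
by rewrite -[c *: (1 : S)]addr0 const_termP E const_term1 mulr1 addr0.
Qed.

Local Notation scalar c := (subalg_scalar (@h_eta_gen K n t u v) c).

Lemma h_eta_ind (P : B -> Prop) :
    (forall c, P (scalar c)) ->
    (forall a b, P a -> P b -> P (a + b)) -> (forall a b, P a -> P b -> P (a * b)) ->
    (forall i, P (heta_eta t u v i)) -> (forall s, P (heta_grp t u v s)) ->
  forall b, P b.
Proof.
move=> Ps PD PM Pe Pg b; pose Q (a : H) := exists2 b' : B, val b' = a & P b'.
suff [b' bb' Pb'] : Q (val b) by have <- : b' = b by exact: val_inj.
have /subalg_ofP := valP b; apply=> [|_ [i|s]]; last first.
- by exists (heta_grp t u v s); last exact: Pg.
- by exists (heta_eta t u v i); last exact: Pe.
split=> [|c _ _ [a <- Pa] [d <- Pd]|_ _ [a <- Pa] [d <- Pd]].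
- by exists (scalar 1); [exact: scale1r | exact: Ps].
- exists (scalar c * a + d); last by apply: PD => //; exact: PM.
  by rewrite rmorphD rmorphM /= -[X in X + _]pres_scalerAl mul1r.
- by exists (a * d); [rewrite rmorphM | exact: PM].
Qed.

(** The subalgebra generated by the eta_i and W preserves the constants, because
    D_i 1 = 0 and W fixes 1; chi is the character by which it acts there. *)
Definition chi (b : B) : K := const_term (daha_act (val b) 1).

Lemma daha_act_chi b : daha_act (val b) 1 = chi b *: (1 : S).
Proof.
suff [c Hc] : exists c, daha_act (val b) 1 = c *: (1 : S) by rewrite /chi Hc const_termZ1.
elim/h_eta_ind: b => [c|a b [x Ha] [y Hb]|a b [x Ha] [y Hb]|i|s].
- by exists c; rewrite /= daha_act_scalar.
- by exists (x + y); rewrite rmorphD daha_actD Ha Hb scalerDl.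
- by exists (y * x); rewrite rmorphM daha_actM Hb daha_actZr Ha scalerA.
- by exists 0; rewrite daha_act_gen /= dunkl1 // scale0r.
- by exists 1; rewrite daha_act_gen /= skew_perm_1 scale1r.
Qed.

Lemma chiM b1 b2 : chi (b1 * b2) = chi b1 * chi b2.
Proof.
rewrite {1}/chi rmorphM daha_actM daha_act_chi daha_actZr daha_act_chi scalerA const_termZ1.
exact: mulrC.
Qed.

Lemma chiD b1 b2 : chi (b1 + b2) = chi b1 + chi b2.
Proof. by rewrite {1}/chi rmorphD daha_actD !daha_act_chi -scalerDl const_termZ1. Qed.

Lemma chi1 : chi 1 = 1.
Proof. by rewrite /chi rmorph1 daha_act1 const_term1. Qed.

Lemma chi_scalar c : chi (scalar c) = c.
Proof. by rewrite /chi /= daha_act_scalar const_termZ1. Qed.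

Lemma chi_eta i : chi (heta_eta t u v i) = 0.
Proof. by rewrite /chi /= daha_act_gen /= dunkl1 // -(scale0r (1 : S)) const_termZ1. Qed.

Lemma chi_grp s : chi (heta_grp t u v s) = 1.
Proof. by rewrite /chi /= daha_act_gen /= skew_perm_1 const_term1. Qed.

Definition triv_module : Type := K.
HB.instance Definition _ := GRing.Zmodule.on triv_module.

Definition triv_module_scale (b : B) (w : triv_module) : triv_module := chi b * (w : K).

Lemma triv_module_scaleA a b w :
  triv_module_scale a (triv_module_scale b w) =
  triv_module_scale (a * b) w.
Proof. by rewrite /triv_module_scale chiM mulrA. Qed.
Lemma triv_module_scale1 : left_id 1 triv_module_scale.
Proof. by move=> w; rewrite /triv_module_scale chi1 mul1r. Qed.
Lemma triv_module_scaleDr : right_distributive triv_module_scale +%R.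
Proof. by move=> b w w'; exact: mulrDr. Qed.
Lemma triv_module_scaleDl w : {morph triv_module_scale^~ w : a b / a + b}.
Proof. by move=> a b; rewrite /triv_module_scale chiD mulrDl. Qed.

HB.instance Definition _ := GRing.Zmodule_isLmodule.Build B triv_module
  triv_module_scaleA triv_module_scale1 triv_module_scaleDr triv_module_scaleDl.

Lemma trivial_module_exists :
  exists (V : lmodType B) (v0 : V), is_trivial_module v0.
Proof.
exists triv_module, (1 : K); split=> [w|a w|i w].
- have E c : scalar c *: ((1 : K) : triv_module) = c.
    by rewrite -[LHS]/(chi _ * 1) chi_scalar mulr1.
  by exists w; split=> [|c]; rewrite E.
- by rewrite -[LHS]/(chi _ * _) chi_grp mul1r.
- by rewrite -[LHS]/(chi _ * _) chi_eta mul0r.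
Qed.

(** * The induced module *)

Section Induced.

Variables (V : lmodType B) (v0 : V).
Hypothesis V_trivial : is_trivial_module v0.

Lemma scalarD c d : scalar (c + d) = scalar c + scalar d.
Proof. by apply: val_inj; rewrite rmorphD /= scalerDl. Qed.

Lemma scalarM c d : scalar (c * d) = scalar c * scalar d.
Proof. by apply: val_inj; rewrite rmorphM /= -[RHS]pres_scalerAl mul1r scalerA. Qed.

Lemma scalar1 : scalar 1 = 1.
Proof. by apply: val_inj; rewrite rmorph1 /= scale1r. Qed.

Lemma scalar0 : scalar 0 = 0.
Proof. by apply: val_inj; rewrite rmorph0 /= scale0r. Qed.

Lemma scalarC c (b : B) : scalar c * b = b * scalar c.
Proof.
apply: val_inj; rewrite !rmorphM /= -[LHS]pres_scalerAl -[RHS]pres_scalerAr.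
by rewrite mulr1 mul1r.
Qed.

(** Any trivial module has the same character as the constants, since both agree
    on generators. *)
Lemma scale_v0 b : b *: v0 = scalar (chi b) *: v0.
Proof.
have [_ Vg Ve] := V_trivial.
elim/h_eta_ind: b => [c|a b Ha Hb|a b Ha Hb|i|s].
- by rewrite chi_scalar.
- by rewrite chiD scalarD !scalerDl Ha Hb.
- by rewrite -scalerA Hb scalerA -scalarC -scalerA Ha scalerA -scalarM chiM mulrC.
- by rewrite Ve chi_eta scalar0 scale0r.
- by rewrite Vg chi_grp scalar1 scale1r.
Qed.

Definition v0_coord (w : V) : K := xget 0 [set c | w = scalar c *: v0]%classic.

Lemma v0_coordP w c : w = scalar c *: v0 -> v0_coord w = c.
Proof.
have [Vs _ _] := V_trivial; have [c0 [_ c0u]] := Vs w.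
move=> wc; apply: xget_unique => // d wd.
by rewrite -(c0u _ wc) -(c0u _ wd).
Qed.

Lemma v0_coordE w : w = scalar (v0_coord w) *: v0.
Proof.
have [Vs _ _] := V_trivial; have [c [wc _]] := Vs w.
by rewrite (v0_coordP wc).
Qed.

Lemma v0_coordD w w' : v0_coord (w + w') = v0_coord w + v0_coord w'.
Proof. by apply: v0_coordP; rewrite scalarD scalerDl -!v0_coordE. Qed.

Lemma v0_coordZ b w : v0_coord (b *: w) = chi b * v0_coord w.
Proof.
apply: v0_coordP; rewrite {1}[w]v0_coordE scalerA -scalarC -scalerA scale_v0.
by rewrite scalerA -scalarM mulrC.
Qed.

(** The map a (x) w |-> a . c with w = c v0; it is balanced since the subalgebra
    acts on v0 and on constants by the same character. *)
Definition ind_to_skew_free (p : tens_free V) : S :=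
  mext (fun (x : H * V) (k : int) => daha_act x.1 (v0_coord x.2 *: (1 : S)) *~ k) p.

Let hB (x : H * V) :
  {morph (fun k : int => daha_act x.1 (v0_coord x.2 *: (1 : S)) *~ k) : k l / k - l}.
Proof. by move=> k l; rewrite mulrzBr. Qed.

Lemma ind_to_skew_freeB : {morph ind_to_skew_free : p q / p - q}.
Proof. exact: (mextB hB). Qed.

Lemma ind_to_skew_freeD : {morph ind_to_skew_free : p q / p + q}.
Proof. exact: (mextD hB). Qed.

Lemma ind_to_skew_free_pair a w :
  ind_to_skew_free (tens_pair a w) = daha_act a (v0_coord w *: (1 : S)).
Proof. by rewrite /ind_to_skew_free /tens_pair -lock (mextU hB). Qed.

Lemma ind_to_skew_free_rel p q :
  tens_relation p q -> ind_to_skew_free p = ind_to_skew_free q.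
Proof.
case=> [a b w|a w w'|a b w]; rewrite ?ind_to_skew_freeD !ind_to_skew_free_pair.
- exact: daha_actD.
- by rewrite v0_coordD !daha_actZr scalerDl.
- by rewrite v0_coordZ daha_actM !daha_actZr daha_act_chi daha_actZr scalerA mulrC.
Qed.

Lemma ind_to_skew_free_null (p : tens_free V) :
  p \in @tens_null _ _ _ V -> ind_to_skew_free p = 0.
Proof.
move=> /tens_nullP /(_ (fun p => ind_to_skew_free p = 0)); apply.
  split=> [|x y Hx Hy]; first exact: (mext0 hB).
  by rewrite ind_to_skew_freeB Hx Hy subrr.
by move=> x y xy; rewrite ind_to_skew_freeB (ind_to_skew_free_rel xy) subrr.
Qed.

Definition ind_to_skew (x : ind_module V) : S := ind_to_skew_free (trepr x).

Lemma ind_to_skew_tpi p : ind_to_skew (tpi p) = ind_to_skew_free p.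
Proof.
have E : trepr (tpi p) - p \in @tens_null _ _ _ V by apply/tpi_eq; exact: tpiK.
apply/eqP; rewrite -subr_eq0; apply/eqP.
by rewrite -(ind_to_skew_free_null E) ind_to_skew_freeB.
Qed.

Lemma ind_to_skewD : {morph ind_to_skew : x y / x + y}.
Proof.
move=> x y; rewrite -[x]tpiK -[y]tpiK -tpiD !ind_to_skew_tpi.
exact: ind_to_skew_freeD.
Qed.

Lemma ind_to_skew_tens a w : ind_to_skew (tens a w) = v0_coord w *: daha_act a 1.
Proof. by rewrite ind_to_skew_tpi ind_to_skew_free_pair daha_actZr. Qed.

Lemma ind_to_skew_act a x : ind_to_skew (a *: x) = daha_act a (ind_to_skew x).
Proof.
move: x; apply: tens_ext => [x y|x y|b w].
- by rewrite scalerDr ind_to_skewD.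
- by rewrite ind_to_skewD -[ind_to_skew x in LHS]scale1r daha_act_linr scale1r.
- by rewrite scale_tens !ind_to_skew_tens daha_actM daha_actZr.
Qed.

Local Notation phi := (skew_to_ind v0).

Lemma skew_to_indK : cancel phi ind_to_skew.
Proof.
move=> f; rewrite /skew_to_ind ind_to_skew_tens daha_act_skew (@v0_coordP v0 1) ?scale1r //.
by rewrite scalar1 scale1r.
Qed.

Lemma daha_scaleA (c : K) (a : H) (x : ind_module V) :
  (c *: a) *: x = (c *: (1 : H)) *: (a *: x).
Proof. by rewrite scalerA -[_ * a]pres_scalerAl mul1r. Qed.

Lemma skew_to_ind_linear c f g : phi (c *: f + g) = (c *: (1 : H)) *: phi f + phi g.
Proof.
have [_ _ El] := skew_to_daha_morph n t u v.
by rewrite /skew_to_ind El tensDl scale_tens -[_ * _]pres_scalerAl mul1r.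
Qed.

Lemma skew_to_indD f g : phi (f + g) = phi f + phi g.
Proof.
have [_ _ El] := skew_to_daha_morph n t u v.
by have := El 1 f g; rewrite !scale1r /skew_to_ind => ->; exact: tensDl.
Qed.

Lemma skew_to_ind_xi i f : phi (xi i * f) = dxi t u v i *: phi f.
Proof. by rewrite /skew_to_ind scale_tens skew_to_daha_xiM. Qed.

Definition in_image (x : ind_module V) : Prop := exists f, x = phi f.

Lemma in_image_lin c x y : in_image x -> in_image y ->
  in_image ((c *: (1 : H)) *: x + y).
Proof.
by move=> [f ->] [g ->]; exists (c *: f + g); rewrite skew_to_ind_linear.
Qed.

Lemma in_image0 : in_image 0.
Proof.
exists 0; apply: (addrI (phi 0)).
by rewrite -skew_to_indD !addr0.
Qed.

Lemma in_image_xi i x : in_image x -> in_image (dxi t u v i *: x).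
Proof.
by move=> [f ->]; exists (xi i * f); rewrite skew_to_ind_xi.
Qed.

Lemma skew_to_ind1 : phi 1 = tens (1 : H) v0.
Proof. by rewrite /skew_to_ind; case: (skew_to_daha_morph n t u v) => ->. Qed.

Lemma daha_scalarC (c : K) (a : H) : a * (c *: (1 : H)) = (c *: (1 : H)) * a.
Proof. by rewrite -[LHS]pres_scalerAr -[RHS]pres_scalerAl mulr1 mul1r. Qed.

(** Reduces the stability of the image under a generator a to the commutation
    of a with the xi_i, because the image is spanned by words in the xi_i applied
    to v0. *)
Lemma in_image_stable (a : H) : in_image (a *: phi 1) ->
    (forall i f, in_image (a *: phi f) -> in_image ((a * dxi t u v i) *: phi f)) ->
  forall x, in_image x -> in_image (a *: x).
Proof.
move=> a1 ax _ [f ->]; elim/skew_ind: f => [c f g Hf Hg||i f Hf].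
- rewrite skew_to_ind_linear scalerDr scalerA daha_scalarC -scalerA.
  exact: in_image_lin.
- exact: a1.
- by rewrite skew_to_ind_xi scalerA; apply: ax; exact: Hf.
Qed.

Lemma in_image_grp s x : in_image x -> in_image (dgrp t u v s *: x).
Proof.
have [_ Vg _] := V_trivial.
move: x; apply: in_image_stable => [|i f Hf].
  exists 1; rewrite skew_to_ind1 scale_tens mulr1 -[dgrp _ _ _ _]mul1r.
  by rewrite -[dgrp _ _ _ _]/(val (heta_grp t u v s)) tens_bal Vg.
have -> : dgrp t u v s * dxi t u v i = dxi t u v (forget s i) * dgrp t u v s.
  by rewrite -[LHS]ppiM -[RHS]ppiM; apply: pres_rel; exact: Daha_grp_xi.
by rewrite -scalerA; exact: in_image_xi.
Qed.

Definition stabilizes (a : H) : Prop := forall x, in_image x -> in_image (a *: x).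

Lemma stabilizes_lin c a b : stabilizes a -> stabilizes b -> stabilizes (c *: a + b).
Proof.
move=> Ha Hb x Hx; rewrite scalerDl daha_scaleA.
by apply: in_image_lin; [exact: Ha | exact: Hb].
Qed.

Lemma stabilizes0 : stabilizes 0.
Proof. by move=> x _; rewrite scale0r; exact: in_image0. Qed.

Lemma stabilizesD a b : stabilizes a -> stabilizes b -> stabilizes (a + b).
Proof. by move=> Ha Hb; rewrite -[a]scale1r; exact: stabilizes_lin. Qed.

Lemma stabilizesZ c a : stabilizes a -> stabilizes (c *: a).
Proof.
by move=> Ha; rewrite -[c *: a]addr0; exact: (stabilizes_lin c Ha stabilizes0).
Qed.

Lemma stabilizes_eta_xi i j :
  stabilizes (deta t u v i * dxi t u v j + dxi t u v j * deta t u v i).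
Proof.
rewrite -[X in X + _]ppiM -[X in _ + X]ppiM -ppiD.
have grp s : stabilizes (ppi _ (fgen K (Dgrp s))) by exact: in_image_grp.
have [<-|ij] := eqVneq i j; last first.
  rewrite (pres_rel (Daha_eta_xi t u v ij)) ppiZ ppiD.
  exact/stabilizesZ/stabilizesD.
rewrite (pres_rel (Daha_eta_xi_diag t u v i)) !ppiD !ppiZ.
apply: stabilizesD; last exact: stabilizesZ.
apply: stabilizesD; first by apply: stabilizesZ => x; rewrite ppi1 scale1r.
apply: stabilizesZ; rewrite (big_morph _ (@ppiD _ _ _) (@ppi0 _ _ _)).
apply: big_ind => [||k _]; [exact: stabilizes0 | exact: stabilizesD|].
by rewrite ppiD; exact: stabilizesD.
Qed.

(** eta_i xi_j = X_ij - xi_j eta_i, where X_ij lies in the span of W. *)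
Lemma in_image_eta i x : in_image x -> in_image (deta t u v i *: x).
Proof.
have [_ _ Ve] := V_trivial.
move: x; apply: in_image_stable => [|j f Hf].
  rewrite skew_to_ind1 scale_tens mulr1 -[deta _ _ _ _]mul1r.
  rewrite -[deta _ _ _ _]/(val (heta_eta t u v i)) tens_bal Ve.
  have -> : tens (1 : H) (0 : V) = 0 by apply: (addrI (tens 1 0)); rewrite -tensDr !addr0.
  exact: in_image0.
have -> : deta t u v i * dxi t u v j = (-1) *: (dxi t u v j * deta t u v i)
    + (deta t u v i * dxi t u v j + dxi t u v j * deta t u v i) :> H.
  by rewrite scaleN1r addrCA addNr addr0.
rewrite scalerDl daha_scaleA -scalerA; apply: in_image_lin; first exact: in_image_xi.
by apply: stabilizes_eta_xi; exists f.
Qed.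

Lemma ind_to_skewK x : phi (ind_to_skew x) = x.
Proof.
move: x; apply: tens_ext => [x y|//|a w]; first by rewrite ind_to_skewD skew_to_indD.
suff [f ->] : in_image (tens a w) by rewrite skew_to_indK.
rewrite [w]v0_coordE -tens_bal; move: (a * _) => {a}a.
elim/pres_ind: a => [c a b Ha Hb||g a Ha].
- have -> : tens (c *: a + b) v0 = (c *: (1 : H)) *: tens a v0 + tens b v0.
    by rewrite tensDl scale_tens -[_ * a]pres_scalerAl mul1r.
  exact: in_image_lin.
- by exists 1; rewrite skew_to_ind1.
- rewrite -scale_tens; case: g => [i|i|s].
  + exact: in_image_xi.
  + exact: in_image_eta.
  + exact: in_image_grp.
Qed.

(** The action is read off from that on skew polynomials by transport along the
    bijection, so no formula has to be checked inside the induced module. *)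
Lemma skew_to_ind_act a f : a *: phi f = phi (daha_act a f).
Proof. by rewrite -[LHS]ind_to_skewK ind_to_skew_act skew_to_indK. Qed.

End Induced.
End PolynomialRepresentation.

Theorem theorem5p13 (R : realType) (n : nat) (t u v : R[i]) :
  [/\ exists (V : lmodType (h_eta n t u v)) (v0 : V), is_trivial_module v0,
      (forall (i : 'I_n) (f : skewpoly R[i] n),
        exists! g, (2%:R * xi i) * g = f - skew_sign i f),
      (forall (i k : 'I_n) (f : skewpoly R[i] n), k != i ->
        exists! g, (xi i ^+ 2 - xi k ^+ 2) * g = dunkl_num i k f)
    & forall (V : lmodType (h_eta n t u v)) (v0 : V), is_trivial_module v0 ->
      let phi : skewpoly R[i] n -> ind_module V := skew_to_ind v0 in
      [/\ bijective phi,
          (forall (c : R[i]) (f g : skewpoly R[i] n),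
            phi (c *: f + g) = (c *: (1 : daha n t u v)) *: phi f + phi g),
          (forall (i : 'I_n) (f : skewpoly R[i] n),
            dxi t u v i *: phi f = phi (xi i * f)),
          (forall (s : signed_perm n) (f : skewpoly R[i] n),
            dgrp t u v s *: phi f = phi (skew_perm (forget s) f))
        & (forall (i : 'I_n) (f : skewpoly R[i] n),
            deta t u v i *: phi f = phi (dunkl t u v i f))]].
Proof.
have two_neq0 : 2%:R != 0 :> R[i] by rewrite Num.Theory.pnatr_eq0.
split.
- exact: trivial_module_exists.
- move=> i f; exists (superder i f); split; first exact: superder_sign.
  by move=> g Hg; apply: (xi_double_lreg two_neq0 (i := i)); rewrite superder_sign.
- move=> i k f ki; have [g Hg] := dunkl_num_div f ki.
  by exists g; split=> // g' Hg'; apply: (xi2_diff_lreg ki); rewrite Hg.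
move=> V v0 V_trivial phi; have act := skew_to_ind_act two_neq0 V_trivial.
split.
- exists (ind_to_skew v0); first exact: skew_to_indK.
  exact: ind_to_skewK.
- exact: skew_to_ind_linear.
- by move=> i f; rewrite /phi act daha_act_gen.
- by move=> s f; rewrite /phi act daha_act_gen.
- by move=> i f; rewrite /phi act daha_act_gen.
Qed.
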